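(* Let $\Gamma$ be a $*$-semigroup that acts on the nonempty set $X$, and let $\mathbf{k}\colon X\times X\to Z$ be a $Z$-valued kernel for some admissible space $Z$. The following assertions are equivalent: (1) $\mathbf{k}$ satisfies the following conditions: (a) $\mathbf{k}$ is weakly positive semidefinite; (b) $\mathbf{k}$ is invariant under the action of $\Gamma$ on $X$, that is, $\mathbf{k}(y,\xi\cdot x)=\mathbf{k}(\xi^*\cdot y,x)$ for all $x,y\in X$ and all $\xi\in\Gamma$; (c) for any $\alpha\in\Gamma$ and any seminorm $p\in S(Z)$, there exist a seminorm $q\in S(Z)$ and a constant $c(\alpha)\ge 0$ such that $$p\Big(\sum_{j,k=1}^n t_j\overline{t_k}\,\mathbf{k}(\alpha\cdot x_k,\alpha\cdot x_j)\Big)\le c(\alpha)^2\, q\Big(\sum_{j,k=1}^n t_j\overline{t_k}\,\mathbf{k}(x_k,x_j)\Big)$$ for all $n\in\mathbb{N}$, all $x_1,\dots,x_n\in X$, and all $t_1,\dots,t_n\in\mathbb{C}$. (2) $\mathbf{k}$ has a continuously adjointable invariant weak VH-space linearisation $(\mathcal{K};\pi;V)$. (3) $\mathbf{k}$ admits a weak $Z$-reproducing kernel VH-space $\mathcal{R}$ and there exists a $*$-representation $\rho\colon\Gamma\to\mathcal{L}^*_{\mathrm{c}}(\mathcal{R})$ such that $\rho(\xi)\mathbf{k}_x=\mathbf{k}_{\xi\cdot x}$ for all $\xi\in\Gamma$, $x\in X$. Moreover, in case any of the assertions (1), (2), or (3) holds, then a topologically minimal continuously adjointable invariant weak VH-space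 linearisation can be constructed (i.e. exists), and a topologically minimal weak $Z$-reproducing kernel VH-space $\mathcal{R}$ as in assertion (3) can be constructed (i.e. exists) as well.
   Context: Ordered $*$-space: a complex vector space $Z$ with (a1) an involution $z\mapsto z^*$ that is conjugate linear and satisfies $(z^* )^*=z$; (a2) a convex cone $Z_+\subseteq Z$ ($sx+ty\in Z_+$ for all real $s,t\ge 0$ and $x,y\in Z_+$) that is strict ($Z_+\cap -Z_+=\{0\}$) and consists of selfadjoint elements only. One writes $z_1\ge z_2$ if $z_1-z_2\in Z_+$. $Z$ is topologically ordered if moreover (a3) $Z$ is a Hausdorff locally convex space; (a4) $Z_+$ is closed; (a5) the topology has a base linearly generated by a family of neighbourhoods of $0$ that are absolutely convex and solid ($x\in N$ and $0\le y\le x$ imply $y\in N$); equivalently, the topology is defined by a family of seminorms $p$ that are increasing ($0\le x\le y$ implies $p(x)\le p(y)$). $S(Z)$ denotes the collection of all increasing continuous seminorms on $Z$. $Z$ is admissible if in addition (a6) its topology is complete. VE-space over $Z$: a complex vector space $\mathcal{E}$ with a $Z$-valued inner product (gramian) $[\cdot,\cdot]_{\mathcal{E}}\colon\mathcal{E}\times\mathcal{E}\to Z$ such that $[x,x]\ge 0$ with $[x,x]=0$ iff $x=0$; $[x,y]=[y,x]^*$; and $[\cdot,\cdot]$ is linear in the second variable. If $Z$ is topologically ordered, $\mathcal{E}$ carries the Hausdorff locally convex topology defined by the seminorms $h\mapsto p([h,h])^{1/2}$, $p\in S(Z)$. If $Z$ and $\mathcal{E}$ are both complete, $\mathcal{E}$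 is a VH-space over $Z$. A linear operator $T\colon\mathcal{K}\to\mathcal{K}$ is adjointable if there is a linear operator $T^*\colon\mathcal{K}\to\mathcal{K}$ with $[Te,f]=[e,T^*f]$ for all $e,f$. $\mathcal{L}^*_{\mathrm{c}}(\mathcal{K})$ is the $*$-algebra of all adjointable linear operators $T$ on $\mathcal{K}$ such that both $T$ and $T^*$ are continuous. A $*$-semigroup is a semigroup $\Gamma$ with an involution $*$ such that $(\xi\eta)^*=\eta^*\xi^*$ and $(\xi^* )^*=\xi$ (no unit is assumed). An action of $\Gamma$ on $X$ is a map $(\xi,x)\mapsto\xi\cdot x\in X$ with $\alpha\cdot(\beta\cdot x)=(\alpha\beta)\cdot x$. A $*$-representation is a multiplicative map $\pi$ with $\pi(\xi^* )=\pi(\xi)^*$. Kernels: a $Z$-valued kernel on $X$ is a map $\mathbf{k}\colon X\times X\to Z$; it is Hermitian if $\mathbf{k}(x,y)=\mathbf{k}(y,x)^*$ for all $x,y$. It is weakly positive semidefinite if for all $n\in\mathbb{N}$, $x_1,\dots,x_n\in X$, $t_1,\dots,t_n\in\mathbb{C}$ one has $\sum_{j,k=1}^n\overline{t_k}t_j\mathbf{k}(x_k,x_j)\ge 0$. A continuously adjointable invariant weak VH-space linearisation of $\mathbf{k}$ and the action of $\Gamma$ on $X$ is a triple $(\mathcal{K};\pi;V)$ where $\mathcal{K}$ is a VH-space over $Z$, $V\colon X\to\mathcal{K}$ is a map with $\mathbf{k}(x,y)=[V(x),V(y)]_{\mathcal{K}}$ for all $x,y\in X$, $\pi\colon\Gamma\to\mathcal{L}^*_{\mathrm{c}}(\mathcal{K})$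 is a $*$-representation, and $V(\xi\cdot x)=\pi(\xi)V(x)$ for all $x\in X$, $\xi\in\Gamma$. It is topologically minimal if the linear span of $V(X)$ is dense in $\mathcal{K}$. A weak $Z$-reproducing kernel VH-space on $X$ with kernel $\mathbf{k}$ ($\mathbf{k}$ Hermitian) is a VH-space $\mathcal{R}$ over $Z$ such that: $\mathcal{R}$ is a vector subspace of $Z^X$ (the space of all functions $X\to Z$); for all $x\in X$ the function $\mathbf{k}_x=\mathbf{k}(\cdot,x)$ belongs to $\mathcal{R}$; and $f(x)=[\mathbf{k}_x,f]_{\mathcal{R}}$ for all $f\in\mathcal{R}$, $x\in X$. ''$\mathbf{k}$ admits'' such a space means one exists with kernel $\mathbf{k}$. It is topologically minimal if the linear span of $\{\mathbf{k}_x\mid x\in X\}$ is dense in $\mathcal{R}$. *)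

(* Defs.v *)
From HB Require Import structures.
From mathcomp Require Import all_boot all_order all_algebra.
From mathcomp Require Import complex.
From mathcomp Require Import ring.
From mathcomp Require Import all_classical all_reals all_analysis.

Set Implicit Arguments.
Unset Strict Implicit.
Unset Printing Implicit Defensive.

Import Order.TTheory GRing.Theory Num.Theory.
Import numFieldTopology.Exports.

Local Open Scope classical_set_scope.
Local Open Scope ring_scope.
Local Open Scope complex_scope.

Local Notation normc := ComplexField.Normc.normc.

Section VectorSpaces.
Variables (R : realType) (E : lmodType R[i]).

Definition is_seminorm (p : E -> R) : Prop :=
  (forall x y, p (x + y) <= p x + p y) /\
  (forall (a : R[i]) x, p (a *: x) = normc a * p x).

Definition absolutely_convex (N : set E) : Prop :=
  forall (a b : R[i]) (x y : E),
    normc a + normc b <= 1 ->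
    N x -> N y -> N (a *: x + b *: y).

(* Neighbourhoods of x in the topology defined by a family P of seminorms:
   the supersets of finite intersections of open P-balls of centre x. *)
Definition seminorm_nbhs (P : set (E -> R)) (x : E) : set_system E :=
  [set U | exists (F : set (E -> R)) (e : R),
     [/\ finite_set F, F `<=` P, 0 < e &
         forall y, (forall p, F p -> p (y - x) < e) -> U y]].

Definition lin_span (A : set E) : set E :=
  [set v | exists (n : nat) (t : 'I_n -> R[i]) (x : 'I_n -> E),
     (forall j, A (x j)) /\ v = \sum_(j < n) t j *: x j].

Lemma seminorm0 p : is_seminorm p -> p 0 = 0.
Proof.
by case=> _ /(_ 0 0); rewrite scale0r ComplexField.Normc.normc0 mul0r.
Qed.

Lemma seminorm_nbhs_filter (P : set (E -> R)) (x : E) :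
  P `<=` is_seminorm -> ProperFilter (seminorm_nbhs P x).
Proof.
move=> PS; apply: Build_ProperFilter_ex.
  move=> U [F [e [_ FP e0 FU]]]; exists x; apply: FU => p /FP/PS/seminorm0.
  by rewrite subrr => ->.
split.
- by exists set0, 1; split.
- move=> U V [F [e [Ff FP e0 FU]]] [G [d [Gf GP d0 GV]]].
  exists (F `|` G), (Num.min e d); split.
  + by rewrite finite_setU.
  + by move=> p [/FP|/GP].
  + by rewrite lt_min e0.
  + move=> y H; split; [apply: FU|apply: GV] => p Hp.
      by have := H p (or_introl Hp); rewrite lt_min => /andP[].
    by have := H p (or_intror Hp); rewrite lt_min => /andP[].
- move=> U V UV [F [e [Ff FP e0 FU]]]; exists F, e; split=> // y H.
  by apply: UV; apply: FU.
Qed.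

Lemma seminorm_nbhs_singleton (P : set (E -> R)) (x : E) (U : set E) :
  P `<=` is_seminorm -> seminorm_nbhs P x U -> U x.
Proof.
move=> PS [F [e [_ FP e0 FU]]]; apply: FU => p /FP/PS/seminorm0.
by rewrite subrr => ->.
Qed.

Lemma seminorm_nbhs_nbhs (P : set (E -> R)) (x : E) (U : set E) :
  P `<=` is_seminorm -> seminorm_nbhs P x U ->
  seminorm_nbhs P x (fun y => seminorm_nbhs P y U).
Proof.
move=> PS [F [e [Ff FP e0 FU]]]; have e20 : 0 < e / 2 by rewrite divr_gt0.
exists F, (e / 2); split=> // y xy; exists F, (e / 2); split=> // z yz.
apply: FU => p Fp; have [+ _] := PS _ (FP _ Fp).
move=> /(_ (z - y) (y - x)); rewrite addrA subrK => /le_lt_trans; apply.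
by rewrite (splitr e) ltrD ?xy ?yz.
Qed.

End VectorSpaces.
Arguments is_seminorm {R E}.

(* Completeness in the linear sense (Cauchy filters are taken with respect to
   the neighbourhoods of 0). The uniform structure carried by a tvsType is only
   required to induce its topology, so completeType would not express this. *)
Section Completeness.
Variables (K : numDomainType) (E : preTopologicalLmodType K).

Definition cauchy_filter (F : set_system E) : Prop :=
  forall U : set E, nbhs (0 : E) U ->
    exists2 A : set E, F A & forall x y, A x -> A y -> U (x - y).

Definition complete_lmod : Prop :=
  forall F : set_system E, ProperFilter F -> cauchy_filter F ->
    exists l : E, F --> l.

End Completeness.

Record ordered_star (R : realType) (Z : lmodType R[i]) := OrderedStar {
  zstar : Z -> Z ;
  zpos : set Z ;
  zstarD : {morph zstar : x y / x + y} ;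
  zstarZ : forall (a : R[i]) x, zstar (a *: x) = a^* *: zstar x ;
  zstarK : involutive zstar ;
  zpos_cone : forall (s t : R) x y, 0 <= s -> 0 <= t -> zpos x -> zpos y ->
    zpos (s%:C *: x + t%:C *: y) ;
  zpos_strict : zpos `&` [set x | zpos (- x)] = [set 0] ;
  zpos_selfadjoint : forall x, zpos x -> zstar x = x
}.

Definition zle (R : realType) (Z : lmodType R[i]) (O : ordered_star Z)
  (x y : Z) : Prop := zpos O (y - x).

Section Admissible.
Variables (R : realType) (Z : tvsType R[i]) (O : ordered_star Z).

Definition solid (N : set Z) : Prop :=
  forall x y, N x -> zle O 0 y -> zle O y x -> N y.

Definition increasing (p : Z -> R) : Prop :=
  forall x y, zle O 0 x -> zle O x y -> p x <= p y.

Definition SZ : set (Z -> R) :=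
  [set p | [/\ is_seminorm p, increasing p & continuous p]].

(* "linearly generated": finite intersections of positive multiples of the
   members of the family form a base at 0 (hence, by translation, at every
   point). *)
Definition solid_base : Prop :=
  exists2 B : set (set Z),
    (forall N, B N -> [/\ nbhs (0 : Z) N, absolutely_convex N & solid N]) &
    (forall U : set Z, nbhs (0 : Z) U ->
       exists (F : set (set Z)) (e : R),
         [/\ finite_set F, F `<=` B, 0 < e &
             forall x, (forall N, F N -> exists2 y, N y & x = e%:C *: y) ->
               U x]).

Definition topologically_ordered : Prop :=
  [/\ hausdorff_space Z, closed (zpos O) & solid_base].

Definition admissible : Prop := topologically_ordered /\ complete_lmod Z.

Record gramian (E : lmodType R[i]) := Gramian {
  gram :> E -> E -> Z ;
  gram_linear : forall x, linear (gram x) ;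
  gram_star : forall x y, gram x y = zstar O (gram y x) ;
  gram_ge0 : forall x, zle O 0 (gram x x) ;
  gram_eq0 : forall x, gram x x = 0 <-> x = 0
}.

Definition gram_seminorms (E : lmodType R[i]) (g : gramian E) : set (E -> R) :=
  [set (fun h => Num.sqrt (p (g h h))) | p in SZ].

Section GramianSeminorms.
Variables (E : lmodType R[i]) (g : gramian E).

Lemma seminorm_ge0 (V : lmodType R[i]) (p : V -> R) x :
  is_seminorm p -> 0 <= p x.
Proof.
move=> pS; have [pD pZ] := pS; have := pD x ((-1) *: x).
rewrite pZ normcN ComplexField.Normc.normc1 mul1r.
by rewrite scaleN1r subrr (seminorm0 pS) -mulr2n pmulrn_lge0.
Qed.

Lemma gramDr x y z : g x (y + z) = g x y + g x z.
Proof. by have := gram_linear g x 1 y z; rewrite !scale1r. Qed.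

Lemma gramZr (a : R[i]) x y : g x (a *: y) = a *: g x y.
Proof.
have g0 : g x 0 = 0.
  by apply: (addrI (g x 0)); rewrite -gramDr !addr0.
by have := gram_linear g x a y 0; rewrite addr0 g0 addr0.
Qed.

Lemma gramDl x y z : g (x + y) z = g x z + g y z.
Proof. by rewrite gram_star gramDr zstarD -!(gram_star g). Qed.

Lemma gramZl (a : R[i]) x y : g (a *: x) y = a^* *: g x y.
Proof. by rewrite gram_star gramZr zstarZ -(gram_star g). Qed.

Lemma gram_le_add (r : R) x y : r != 0 ->
  zle O (g (x + y) (x + y))
    ((1 + r ^+ 2)%:C *: g x x + (1 + r ^- 2)%:C *: g y y).
Proof.
move=> r0.
have := gram_ge0 g (r%:C *: x + (- r^-1)%:C *: y).
rewrite /zle subr0 !(gramDl, gramDr, gramZl, gramZr) !scalerDr !scalerA.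
congr (zpos O _).
have cR (a b : R) : (a%:C)^* * b%:C = (a * b)%:C by simpc.
rewrite !cR mulrN mulNr mulrNN -!expr2 mulfV // mulVf // exprVn.
rewrite (rmorphN (real_complex R)) !(rmorphD (real_complex R)).
rewrite !(rmorph1 (real_complex R)) !scaleN1r !scalerDl !scale1r.
set a := g x x; set b := g y y; set c := g x y; set d := g y x.
set u := _ *: a; set v := _ *: b.
rewrite [- d + v]addrC [d + b]addrC (addrACA u) -opprD.
by rewrite (addrACA a u) (addrACA a c) [- (a + b + _)]opprD [RHS]addrACA subrr add0r.
Qed.

Lemma gram_seminormP : gram_seminorms g `<=` is_seminorm.
Proof.
move=> _ [p [pS pI _] <-]; have [pD pZ] := pS; split=> [x y|a x]; last first.
  rewrite gramZl gramZr scalerA pZ.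
  have -> : normc (a^* * a) = normc a ^+ 2.
    rewrite ComplexField.Normc.normcM expr2; congr (_ * _).
    by case: a => u v; rewrite /normc /= sqrrN.
  rewrite sqrtrM ?sqr_ge0// sqrtr_sqr ger0_norm//.
  by rewrite /normc; case: a => u v; rewrite sqrtr_ge0.
set a := p (g x x); set b := p (g y y).
have a0 : 0 <= a by apply: seminorm_ge0.
have b0 : 0 <= b by apply: seminorm_ge0.
apply/ler_addgt0Pr => e e0.
set u := Num.sqrt a + e / 2; set v := Num.sqrt b + e / 2.
have u0 : 0 < u by rewrite ltr_wpDl ?sqrtr_ge0 ?divr_gt0.
have v0 : 0 < v by rewrite ltr_wpDl ?sqrtr_ge0 ?divr_gt0.
have au : a <= u ^+ 2.
  rewrite -[leLHS]sqr_sqrtr// lerXn2r ?nnegrE ?sqrtr_ge0 ?(ltW u0)//.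
  by rewrite lerDl divr_ge0// ltW.
have bv : b <= v ^+ 2.
  rewrite -[leLHS]sqr_sqrtr// lerXn2r ?nnegrE ?sqrtr_ge0 ?(ltW v0)//.
  by rewrite lerDl divr_ge0// ltW.
have -> : Num.sqrt a + Num.sqrt b + e = u + v.
  by rewrite addrACA -splitr.
have uv0 : 0 <= u + v by rewrite addr_ge0// ltW.
rewrite -[leRHS](ger0_norm uv0) -sqrtr_sqr.
apply: ler_wsqrtr.
have r0 : 0 < v / u by rewrite divr_gt0.
have rn0 : Num.sqrt (v / u) != 0 by rewrite gt_eqF// sqrtr_gt0.
apply: (le_trans (pI _ _ (gram_ge0 g _) (gram_le_add x y rn0))).
rewrite sqr_sqrtr ?(ltW r0)//.
apply: (le_trans (pD _ _)); rewrite !pZ -/a -/b.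
have nR (s : R) : 0 <= s -> normc s%:C = s.
  by move=> s0; rewrite /normc /= expr0n addr0 sqrtr_sqr ger0_norm.
rewrite !nR ?addr_ge0 ?invr_ge0 ?(ltW r0)// invf_div.
have -> : (u + v) ^+ 2 = (1 + v / u) * u ^+ 2 + (1 + u / v) * v ^+ 2.
  field.
  by rewrite !gt_eqF.
by rewrite lerD// ler_wpM2l// addr_ge0// divr_ge0 ?(ltW u0) ?(ltW v0).
Qed.
End GramianSeminorms.

(* A copy of E carrying the topology defined by the seminorms
   h |-> p([h, h])^(1/2), p in S(Z). *)
Definition vespace (E : lmodType R[i]) (g : gramian E) : Type := E.

End Admissible.

HB.instance Definition _ (R : realType) (Z : tvsType R[i])
    (O : ordered_star Z) (E : lmodType R[i]) (g : gramian O E) :=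
  GRing.Lmodule.copy (vespace g) E.

HB.instance Definition _ (R : realType) (Z : tvsType R[i])
    (O : ordered_star Z) (E : lmodType R[i]) (g : gramian O E) :=
  hasNbhs.Build (vespace g) (@seminorm_nbhs R E (gram_seminorms g)).

HB.instance Definition _ (R : realType) (Z : tvsType R[i])
    (O : ordered_star Z) (E : lmodType R[i]) (g : gramian O E) :=
  Nbhs_isNbhsTopological.Build (vespace g)
    (fun x => seminorm_nbhs_filter x (@gram_seminormP R Z O E g))
    (fun x U => seminorm_nbhs_singleton (@gram_seminormP R Z O E g))
    (fun x U => seminorm_nbhs_nbhs (@gram_seminormP R Z O E g)).

Section Operators.
Variables (R : realType) (Z : tvsType R[i]) (O : ordered_star Z).
Variables (K : lmodType R[i]) (g : gramian O K).

(* Completeness of Z is part of [admissible O]. *)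
Definition vh_space : Prop := complete_lmod (vespace g).

Definition is_adjoint (T Tstar : {linear K -> K}) : Prop :=
  forall e f, g (T e) f = g e (Tstar f).

Definition ve_continuous (T : {linear K -> K}) : Prop :=
  continuous (T : vespace g -> vespace g).

Definition Lcstar : set {linear K -> K} :=
  [set T | exists Tstar : {linear K -> K},
     [/\ is_adjoint T Tstar, ve_continuous T & ve_continuous Tstar]].

Definition ve_dense (A : set K) : Prop := dense (A : set (vespace g)).

End Operators.

Record star_semigroup (G : semigroupType) := StarSemigroup {
  sgstar :> G -> G ;
  sgstarM : forall x y : G, sgstar (x * y)%g = (sgstar y * sgstar x)%g ;
  sgstarK : involutive sgstar
}.

Record action_on (G : semigroupType) (X : Type) := ActionOn {
  act :> G -> X -> X ;
  actA : forall (a b : G) x, act a (act b x) = act (a * b)%g x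
}.

(* Adjoints are unique, so the last clause says pi (xi^* ) = (pi xi)^*. *)
Definition star_representation (R : realType) (Z : tvsType R[i])
    (O : ordered_star Z) (G : semigroupType) (star : star_semigroup G)
    (K : lmodType R[i]) (g : gramian O K) (pi : G -> {linear K -> K}) : Prop :=
  [/\ forall xi, Lcstar g (pi xi),
      forall xi eta h, pi (xi * eta)%g h = pi xi (pi eta h) &
      forall xi, is_adjoint g (pi xi) (pi (star xi))].

Section Kernels.
Variables (R : realType) (Z : tvsType R[i]) (O : ordered_star Z).
Variables (X : Type) (k : X -> X -> Z).

Definition hermitian_kernel : Prop := forall x y, k x y = zstar O (k y x).

Definition weakly_psd : Prop :=
  forall (n : nat) (x : 'I_n -> X) (t : 'I_n -> R[i]),
    zle O 0 (\sum_(j < n) \sum_(l < n) ((t l)^* * t j) *: k (x l) (x j)).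

Variables (G : semigroupType) (star : star_semigroup G) (a : action_on G X).

Definition invariant_kernel : Prop :=
  forall x y xi, k y (a xi x) = k (a (star xi) y) x.

Definition bounded_shifts : Prop :=
  forall (alpha : G) (p : Z -> R), SZ O p ->
    exists (q : Z -> R) (c : R), [/\ SZ O q, 0 <= c &
      forall (n : nat) (x : 'I_n -> X) (t : 'I_n -> R[i]),
        p (\sum_(j < n) \sum_(l < n)
             (t j * (t l)^* ) *: k (a alpha (x l)) (a alpha (x j)))
        <= c ^+ 2 *
           q (\sum_(j < n) \sum_(l < n) (t j * (t l)^* ) *: k (x l) (x j))].

Definition weak_vh_linearisation (K : lmodType R[i]) (g : gramian O K)
    (pi : G -> {linear K -> K}) (V : X -> K) : Prop :=
  [/\ vh_space g,
      forall x y, k x y = g (V x) (V y),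
      star_representation star g pi &
      forall x xi, V (a xi x) = pi xi (V x)].

Definition minimal_linearisation (K : lmodType R[i]) (g : gramian O K)
    (V : X -> K) : Prop :=
  ve_dense g (lin_span (range V)).

(* S is a vector subspace of the space of functions X -> Z, cut out by P, and
   kx x is the element of S whose underlying function is k(., x). *)
Definition weak_rk_vhspace (P : pred (X -> Z))
    (S : subLmodType P) (g : gramian O S) (kx : X -> S) : Prop :=
  [/\ hermitian_kernel, vh_space g,
      forall x, \val (kx x) = k^~ x &
      forall (f : S) x, \val f x = g (kx x) f].

Definition minimal_rk (S : lmodType R[i]) (g : gramian O S) (kx : X -> S) :=
  ve_dense g (lin_span (range kx)).

Definition rk_representation (S : lmodType R[i]) (g : gramian O S)
    (kx : X -> S) (rho : G -> {linear S -> S}) : Prop :=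
  star_representation star g rho /\
  forall xi x, rho xi (kx x) = kx (a xi x).

End Kernels.

(* Main.v *)
Require Import Defs.
From HB Require Import structures.
From mathcomp Require Import all_boot all_order all_algebra.
From mathcomp Require Import complex.
From mathcomp Require Import ring lra.
From mathcomp Require Import all_classical all_reals all_analysis.

Set Implicit Arguments.
Unset Strict Implicit.
Unset Printing Implicit Defensive.

Import Order.TTheory GRing.Theory Num.Theory.
Import numFieldTopology.Exports.

Local Open Scope classical_set_scope.
Local Open Scope complex_scope.
Local Open Scope ring_scope.

Local Notation normc := ComplexField.Normc.normc.

(** The implications from P2 to P1 and from P3 to P2 are direct: in a
    linearisation the sums that appear in P1 are the squares [v, v] of the
    vectors v = sum_j t_j V(x_j), and a reproducing kernel space with its
    kernel sections is a linearisation. Everything else follows from a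
    topologically minimal reproducing kernel space built from P1.

    That space is the completion of the span of the kernel sections k_x, which
    carries the inner product [k_x, k_y] = k(x, y). The completion is realized
    concretely inside the functions from X to Z. A finite combination
    u = sum_i s_i k_(x_i) pairs with every function f by the value
    sum_i s_i^* f(x_i) (cform), and the norm of f as a functional on
    combinations (dual_bound) is equivalent on combinations to the norm of the
    inner product, by a Cauchy-Schwarz inequality for increasing seminorms
    (psd2_bound). The elements of the space are the functions that combinations
    approximate in the dual norm (approximable); no Cauchy filter enters their
    definition, and the dual norm passes to pointwise limits.

    The gramian of f and h is the limit in Z of the pairings of h with
    combinations that approximate f (pairing); here completeness of Z is used.
    It is positive because the cone is closed (pairing_psd2). Hermitian symmetry
    cannot be obtained as a limit, since the involution need not be continuous;
    it follows from positivity by polarization (psd2_hermitian). Completeness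
    of the space is proved by taking pointwise limits (rk_complete).

    By invariance, the operator that sends k_x to k_(xi x) must be composition
    with the action of xi^*, so that the representation is given by a formula on
    all functions and is multiplicative and linear at sight. The bound on shifts
    in P1 shows that it preserves approximability and is continuous
    (dual_bound_shift), and the adjoint relation passes from combinations to
    limits (rk_shift_adjoint).

    All estimates use the seminorms in S(Z). They generate the topology of Z
    because the Minkowski functional of a solid absolutely convex neighbourhood
    of 0 is an increasing continuous seminorm (nbhs0_SZ). *)

(** * Scalars and the cone *)

Section Scalars.
Variable R : realType.
Implicit Types r t : R.

Lemma ler_forall_gt (s t : R) : (forall r, t < r -> s <= r) -> s <= t.
Proof.
by move=> H; apply/ler_addgt0Pr => e e0; apply: H; rewrite ltrDl.
Qed.

(** Estimates pass to limits below in this form, the parameter d being the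
    quality of an approximation. *)
Lemma ler_forall_addM (x y C : R) : (forall d, 0 < d -> x <= y + C * d) ->
  x <= y.
Proof.
move=> H; apply/ler_addgt0Pr => e e0.
have C0 : 0 < `|C| + 1 by rewrite ltr_wpDl.
apply: le_trans (H _ (divr_gt0 e0 C0)) _; rewrite lerD2l.
rewrite mulrCA ger_pMr// ler_pdivrMr// mul1r.
by rewrite (le_trans (ler_norm _))// lerDl.
Qed.

Lemma normc_real r : 0 <= r -> normc r%:C = r.
Proof. by move=> r0; rewrite /normc /= expr0n addr0 sqrtr_sqr ger0_norm. Qed.

Lemma normc_ge0 (a : R[i]) : 0 <= normc a.
Proof. by case: a => u v; apply: sqrtr_ge0. Qed.

Lemma normc_conj (a : R[i]) : normc a^* = normc a.
Proof. by case: a => u v; rewrite /normc /= sqrrN. Qed.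

Lemma conj_real r : (r%:C)^* = r%:C :> R[i].
Proof. by apply/eqP; rewrite eq_complex /= oppr0 !eqxx. Qed.

Lemma conj_i : ('i%C : R[i])^* = - 'i%C.
Proof. by apply/eqP; rewrite eq_complex /= oppr0 !eqxx. Qed.

Lemma mul_ii : 'i%C * 'i%C = -1 :> R[i].
Proof. by rewrite -expr2 sqr_i. Qed.

Lemma real_complexM r t : (r * t)%:C = r%:C * t%:C :> R[i].
Proof. exact: (rmorphM (real_complex R)). Qed.

Lemma real_complex_eq0 r : (r%:C == 0 :> R[i]) = (r == 0).
Proof. by rewrite eq_complex /= eqxx andbT. Qed.

End Scalars.

Section ZmodIdentities.
Variables (V : zmodType) (a b c d : V).

Let regroup : a + c + d + b = (a + b) + (c + d).
Proof. by rewrite addrAC (addrAC a c) -addrA. Qed.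

Let regroupN : a - c - d + b = (a + b) - (c + d).
Proof. by rewrite addrAC (addrAC a (- c)) -addrA opprD. Qed.

(** With a and b the diagonal terms and c and d the cross terms of a quadratic
    expression, this and the next identity compare its values at v + w and v -
    w. *)
Lemma sub_flip_cross : a + a + (b + b) - (a + c + d + b) = a - c - d + b.
Proof.
rewrite regroup regroupN (addrACA a); move: (a + b) (c + d) => s t.
by rewrite opprD addrA addrK.
Qed.

Lemma sub_opp_cross : a + c + d + b - (a - c - d + b) = (c + d) + (c + d).
Proof.
rewrite regroup regroupN; move: (a + b) (c + d) => s t.
by rewrite opprB [s + t]addrC addrA addrAC addrK.
Qed.

End ZmodIdentities.

Section Cone.
Variables (R : realType) (Z : lmodType R[i]) (O : ordered_star Z).
Implicit Types (x : Z) (r : R).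

Lemma zpos_scale r x : 0 <= r -> zpos O x -> zpos O (r%:C *: x).
Proof.
move=> r0 x0; have := zpos_cone r0 (lexx 0) x0 x0.
by rewrite (rmorph0 (real_complex R)) scale0r addr0.
Qed.

Lemma zle0 x : zle O 0 x <-> zpos O x.
Proof. by rewrite /zle subr0. Qed.

End Cone.

(** * Increasing seminorms generate the topology *)

Section Gauge.
Variables (R : realType) (Z : tvsType R[i]) (O : ordered_star Z).
Implicit Types (N : set Z) (x y : Z) (r t : R).

(** The Minkowski functional of N. *)
Definition gauge N x : R :=
  inf [set t | 0 < t /\ exists2 y, N y & x = t%:C *: y].

Hypotheses (N : set Z) (N0 : nbhs (0 : Z) N) (Nac : absolutely_convex N)
  (Nsolid : solid O N).

Let N_zero : N 0. Proof. exact: nbhs_singleton. Qed.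

Let gauge_lb x : lbound [set t | 0 < t /\ exists2 y, N y & x = t%:C *: y] 0.
Proof. by move=> t [/ltW]. Qed.

Let gauge_nonempty x : [set t | 0 < t /\ exists2 y, N y & x = t%:C *: y] !=set0.
Proof.
have := @scale_continuous _ Z (0, x).
rewrite /continuous_at /= scale0r => /(_ N N0) [[/= A B] [A0 Bx] AB].
have [e /= e0 eA] := A0.
(* The radius e of the ball of scalars is complex; d is half its real part. *)
have [d d0 dC] : exists2 d : R, 0 < d & `|d%:C : R[i]| < e.
  case: e e0 eA => er ei; rewrite ltcE /= => /andP[/eqP -> er0] _.
  exists (er / 2); first by rewrite divr_gt0.
  rewrite normc_def /= ltcE /= eqxx /= expr0n addr0 sqrtr_sqr ger0_norm.
    by rewrite gtr_pMr// invf_lt1 // ltr1n.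
  by rewrite divr_ge0 // ltW.
exists d^-1; split; first by rewrite invr_gt0.
exists (d%:C *: x).
  apply: (AB (_, _)); split; last exact: nbhs_singleton.
  by apply: eA; rewrite /= sub0r normrN.
rewrite scalerA -real_complexM mulVf ?scale1r// gt_eqF//.
Qed.

Let gauge_has_inf x :
  has_inf [set t | 0 < t /\ exists2 y, N y & x = t%:C *: y].
Proof. by split; [exact: gauge_nonempty|exists 0; exact: gauge_lb]. Qed.

Lemma gauge_le t y : 0 < t -> N y -> gauge N (t%:C *: y) <= t.
Proof.
by move=> t0 Ny; apply: ge_inf; [exists 0; exact: gauge_lb|split=> //;
  exists y].
Qed.

Lemma gauge_lt x r : gauge N x < r ->
  exists t y, [/\ 0 < t, t < r, N y & x = t%:C *: y].
Proof.
move=> xr; have := xr; rewrite -subr_gt0 => /inf_adherent/(_ (gauge_has_inf x)).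
by case=> t [t0 [y Ny ->]]; rewrite -/(gauge N x) addrC subrK; exists t, y.
Qed.

Lemma gauge_lt1 x : gauge N x < 1 -> N x.
Proof.
case/gauge_lt => t [y [t0 t1 Ny ->]].
rewrite -[_ *: y]addr0 -[X in _ + X](scaler0 _ 0); apply: Nac => //.
by rewrite ComplexField.Normc.normc0 addr0 normc_real ltW.
Qed.

Let gaugeZ_le (b : R[i]) x : b != 0 -> gauge N (b *: x) <= normc b * gauge N x.
Proof.
move=> b0; have nb0 : 0 < normc b.
  rewrite lt_neqAle normc_ge0 andbT eq_sym.
  by apply: contra b0 => /eqP/ComplexField.Normc.eq0_normc ->.
rewrite mulrC -ler_pdivrMr//.
have nbC : (normc b)%:C != 0 :> R[i] by rewrite real_complex_eq0 gt_eqF.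
apply: ler_forall_gt => r /gauge_lt[t [y [t0 /ltW tr Ny ->]]].
rewrite ler_pdivrMr//; apply: le_trans (_ : t * normc b <= _); last first.
  by rewrite ler_wpM2r// ltW.
have -> : b *: (t%:C *: y) = (t * normc b)%:C *: ((b / (normc b)%:C) *: y).
  rewrite !scalerA real_complexM; congr (_ *: _).
  by field; exact: nbC.
apply: gauge_le; first by rewrite mulr_gt0.
rewrite -[_ *: y]addr0 -[X in _ + X](scaler0 _ 0); apply: Nac => //.
rewrite ComplexField.Normc.normc0 addr0 ComplexField.Normc.normcM.
rewrite -(rmorphV (real_complex R)) ?unitfE ?gt_eqF//.
rewrite normc_real ?invr_ge0 ?(ltW nb0)//.
by rewrite divff ?(gt_eqF nb0).
Qed.

Lemma gauge_seminorm : is_seminorm (gauge N).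
Proof.
split=> [x y|b x]; last first.
  have [->|b0] := eqVneq b 0.
    rewrite scale0r ComplexField.Normc.normc0 mul0r; apply/eqP.
    rewrite eq_le; apply/andP; split; last first.
      by apply: lb_le_inf; [exact: gauge_nonempty|exact: gauge_lb].
    apply: ler_forall_gt => r r0; rewrite -(scaler0 _ (r%:C)).
    exact: gauge_le.
  apply/eqP; rewrite eq_le gaugeZ_le//=.
  have nb0 : normc b != 0.
    by apply: contra b0 => /eqP/ComplexField.Normc.eq0_normc ->.
  have bV0 : b^-1 != 0 by rewrite invr_eq0.
  have := gaugeZ_le (b *: x) bV0.
  rewrite scalerA mulVf// scale1r => /(ler_wpM2l (normc_ge0 b)).
  rewrite mulrA -ComplexField.Normc.normcM mulfV//.
  by rewrite ComplexField.Normc.normc1 mul1r.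
apply/ler_addgt0Pr => e e0.
have [|t [x' [t0 tx Nx xE]]] := @gauge_lt x (gauge N x + e / 2).
  by rewrite ltrDl divr_gt0.
have [|s [y' [s0 sy Ny yE]]] := @gauge_lt y (gauge N y + e / 2).
  by rewrite ltrDl divr_gt0.
rewrite (splitr e) addrACA.
apply: (@le_trans _ _ (t + s)); last by apply: lerD; apply: ltW.
have ts0 : 0 < t + s by rewrite addr_gt0.
have -> : x + y =
    (t + s)%:C *: ((t / (t + s))%:C *: x' + (s / (t + s))%:C *: y').
  by rewrite xE yE scalerDr !scalerA -!real_complexM !(mulrC (t +
    s)) !divfK ?gt_eqF.
apply: gauge_le => //; apply: Nac => //.
rewrite !normc_real ?divr_ge0 ?(ltW ts0) ?(ltW t0) ?(ltW s0)//.
by rewrite -mulrDl divff// gt_eqF.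
Qed.

(** Dividing by t preserves the order, so solidity of N carries over from y / t
    to x / t. *)
Lemma gauge_increasing : increasing O (gauge N).
Proof.
move=> x y x0 xy; apply: ler_forall_gt => r /gauge_lt[t [z [t0 /ltW tr Nz yE]]].
have tV0 : 0 <= t^-1 by rewrite invr_ge0 ltW.
have tK w : t^-1%:C *: (t%:C *: w) = w.
  by rewrite scalerA -real_complexM mulVf ?gt_eqF// scale1r.
have -> : x = t%:C *: (t^-1%:C *: x).
  by rewrite scalerA -real_complexM mulfV ?gt_eqF// scale1r.
apply: le_trans tr; apply: gauge_le => //; apply: (Nsolid Nz).
  by move: x0; rewrite /zle !subr0 => /(zpos_scale tV0).
by move: xy; rewrite /zle yE => /(zpos_scale tV0); rewrite scalerBr tK.
Qed.

End Gauge.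

Section SeminormTopology.
Variables (R : realType) (Z : tvsType R[i]) (O : ordered_star Z).

Lemma seminormN (E : lmodType R[i]) (p : E -> R) x : is_seminorm p ->
  p (- x) = p x.
Proof.
move=> [_ pZ]; rewrite -scaleN1r pZ normcN.
by rewrite ComplexField.Normc.normc1 mul1r.
Qed.

Lemma seminorm_continuous (p : Z -> R) : is_seminorm p ->
  (forall e : R, 0 < e -> nbhs (0 : Z) [set x | p x < e]) -> continuous p.
Proof.
move=> pS p0 x; apply/cvgrPdist_lt => e e0.
have := nbhsT x (p0 e e0); apply: filterS => y [z /= ze <-].
have [pD _] := pS.
have h1 := pD x z; have := pD (x + z) (- z); rewrite addrK seminormN// => h2.
rewrite /= in ze; rewrite ltr_norml; apply/andP; split; lra.
Qed.

Lemma gauge_SZ (N : set Z) : nbhs (0 : Z) N -> absolutely_convex N ->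
  solid O N -> SZ O (gauge N).
Proof.
move=> N0 Nac Ns; split; [exact: gauge_seminorm|exact: gauge_increasing|].
apply: seminorm_continuous; first exact: gauge_seminorm.
move=> e e0; have e20 : 0 < e / 2 by rewrite divr_gt0.
have : (e / 2)%:C != 0 :> R[i] by rewrite real_complex_eq0 gt_eqF.
move=> /nbhs0Z/(_ N0); apply: filterS => _ [y Ny <-] /=.
apply: le_lt_trans (gauge_le e20 Ny) _.
by rewrite gtr_pMr// invf_lt1 // ltr1n.
Qed.

Lemma SZ0 : SZ O (fun=> 0).
Proof.
split; [split=> *; rewrite ?mulr0 ?addr0//|by move=> *|by move=> x;
  exact: cvg_cst].
Qed.

(** This makes the family SZ directed: two seminorms are dominated by their sum.
    *)
Lemma SZD p q : SZ O p -> SZ O q -> SZ O (fun x => p x + q x).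
Proof.
move=> [[pD pZ] pI pC] [[qD qZ] qI qC]; split.
- split=> [x y|b x]; last by rewrite pZ qZ mulrDr.
  by rewrite addrACA lerD.
- by move=> x y x0 xy; rewrite lerD ?pI ?qI.
- by move=> x; apply: cvgD; [exact: pC|exact: qC].
Qed.

Lemma SZ_scale (r : R) p : 0 <= r -> SZ O p -> SZ O (fun x => r * p x).
Proof.
move=> r0 [[pD pZ] pI pC]; split.
- split=> [x y|b x]; last by rewrite pZ mulrCA.
  by rewrite -mulrDr ler_wpM2l.
- by move=> x y x0 xy; rewrite ler_wpM2l ?pI.
- by move=> x; apply: cvgMl_tmp; exact: pC.
Qed.

Lemma SZ_ge0 p x : SZ O p -> 0 <= p x.
Proof. by case=> pS _ _; exact: seminorm_ge0. Qed.

Hypothesis Ztop : topologically_ordered O.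

(** A basic neighbourhood is a finite intersection of multiples of solid
    absolutely convex sets; the rescaled sum of their gauges controls all of
    them at once. *)
Lemma nbhs0_SZ (U : set Z) : nbhs (0 : Z) U ->
  exists2 p, SZ O p & forall x, p x < 1 -> U x.
Proof.
case: Ztop => _ _ [B BP Bbase] /Bbase[F [e [/finite_seqP[s ->] FB e0 FU]]].
have [p pS pF] : exists2 p, SZ O p &
    forall x, p x < 1 -> forall N, N \in s -> N x.
  elim: s FB {FU} => [|N s IH] sB; first by exists (fun=> 0); [exact: SZ0|].
  have [|p pS ps] := IH; first by move=> M Ms; apply: sB;
    rewrite /= inE Ms orbT.
  have [N0 Nac Ns] : [/\ nbhs (0 : Z) N, absolutely_convex N & solid O N].
    by apply/BP/sB; rewrite /= inE eqxx.
  have NS := gauge_SZ N0 Nac Ns.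
  exists (fun x => gauge N x + p x); first exact: SZD.
  move=> x x1 M; rewrite inE => /predU1P[->|Ms].
    apply: (gauge_lt1 N0 Nac).
    by apply: le_lt_trans x1; rewrite lerDl SZ_ge0.
  by apply: ps Ms; apply: le_lt_trans x1; rewrite lerDr (SZ_ge0 _ NS).
exists (fun x => e^-1 * p x); first by apply: SZ_scale => //;
  rewrite invr_ge0 ltW.
move=> x x1; apply: FU => N /= Ns; exists ((e^-1)%:C *: x); last first.
  by rewrite scalerA -real_complexM mulfV ?gt_eqF// scale1r.
apply: pF Ns; have [[_ pZ] _ _] := pS.
by rewrite pZ normc_real// invr_ge0 ltW.
Qed.

Lemma nbhs_SZ (x : Z) (U : set Z) : nbhs x U ->
  exists2 p, SZ O p & forall y, p (x - y) < 1 -> U y.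
Proof.
move=> /(nbhsB (- x)); rewrite addNr => /nbhs0_SZ[p pS pU].
exists p => // y; rewrite -(seminormN (x - y)); last by case: pS.
by rewrite opprB => /pU[z Uz /eqP]; rewrite addrC subr_eq subrK => /eqP <-.
Qed.

Lemma SZ_ball_nbhs (x : Z) p (e : R) : SZ O p -> 0 < e ->
  nbhs x [set y | p (x - y) < e].
Proof.
case=> pS _ pC e0.
have [B B0 BE] : exists2 B, nbhs (0 : Z) B & forall y, B y -> p y < e.
  exists [set y | p y < e] => //.
  have /cvgrPdist_lt/(_ e e0) := pC 0; apply: filterS => y /=.
  by rewrite (seminorm0 pS) sub0r normrN ger0_norm// seminorm_ge0.
have := nbhsT x B0; apply: filterS => y [z Bz <-] /=.
by rewrite opprD addNKr seminormN// BE.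
Qed.

Lemma cvg_SZ (F : set_system Z) (x : Z) : Filter F ->
  (forall p (e : R), SZ O p -> 0 < e -> F [set y | p (x - y) < e]) <-> F --> x.
Proof.
move=> FF; split=> [H U /nbhs_SZ[p pS pU]|Fx p e pS e0].
  exact: filterS (H p 1 pS ltr01).
exact/Fx/SZ_ball_nbhs.
Qed.

(** Hausdorffness of Z in the form in which equalities are proved below. *)
Lemma SZ_separates (x : Z) : (forall p, SZ O p -> p x <= 0) -> x = 0.
Proof.
move=> x0; case: Ztop => Zh _ _; apply/esym/Zh => A B A0 /nbhs_SZ[p pS pB].
exists 0; split; first exact: nbhs_singleton.
by apply: pB; rewrite subr0 (le_lt_trans (x0 _ pS)).
Qed.

(** Closedness of the cone in terms of seminorms: the way in which positivity
    passes to limits. *)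
Lemma zpos_SZ_closed (x : Z) :
  (forall p (e : R), SZ O p -> 0 < e -> exists2 y, zpos O y & p (x - y) < e) ->
  zpos O x.
Proof.
move=> H; case: Ztop => _ cl _; apply: cl => U /nbhs_SZ[p pS pU].
by have [y y0 /pU Uy] := H p 1 pS ltr01; exists y.
Qed.

End SeminormTopology.

(** * Positive two-by-two matrices over an ordered space *)

Section TwoByTwo.
Variables (R : realType) (Z : tvsType R[i]) (O : ordered_star Z).
Variables (a b c d : Z).
Hypothesis abcd_psd : forall s t : R[i],
  zpos O ((s^* * s) *: a + (s^* * t) *: c + (t^* * s) *: d + (t^* * t) *: b).

(** The value of the form at (1, 1) and at (1, 'i) is selfadjoint, which
    determines the two off-diagonal entries from each other. Continuity of the
    involution is not assumed, so symmetry of a limit has to come from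
    positivity in this way. *)
Lemma psd2_hermitian : d = zstar O c.
Proof.
have starN x : zstar O (- x) = - zstar O x.
  by rewrite -scaleN1r zstarZ rmorphN rmorph1 scaleN1r.
have sa := zpos_selfadjoint (abcd_psd _ _).
have := sa 1 0; rewrite !(rmorph1, rmorph0, mul0r, mulr0, mul1r, scale0r,
  scale1r, addr0) => sa_a.
have := sa 0 1; rewrite !(rmorph1, rmorph0, mul0r, mulr0, mul1r, scale0r,
  scale1r, add0r) => sa_b.
have := sa 1 1; rewrite !(rmorph1, mul1r, scale1r) !zstarD sa_a sa_b => /addIr.
rewrite -!addrA => /addrI sum1.
have := sa 1 'i%C; rewrite !(rmorph1, mul1r, mulr1, scale1r) conj_i !zstarD
  sa_a !zstarZ.
rewrite mulNr mul_ii opprK rmorph1 !scale1r sa_b => /addIr.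
rewrite -!addrA => /addrI.
rewrite rmorphN /= conj_i opprK !scaleNr => /(congr1 (fun x => 'i%C *: x)).
rewrite !scalerDr !scalerN !scalerA mul_ii !scaleN1r !opprK => sum2.
have : d + d = zstar O c + zstar O c.
  transitivity ((c + d) + (- c + d)); first by rewrite addrACA subrr add0r.
  by rewrite -sum1 -sum2 addrACA subrr addr0.
have half (x : Z) : x = (1 / 2 : R[i]) *: (x + x).
  by rewrite scalerDr -scalerDl -splitr scale1r.
by move=> dd; rewrite [d]half dd -half.
Qed.

(** The Cauchy-Schwarz inequality for an increasing seminorm. No bound on c is
    available directly, since p is monotone only on the cone. By polarization c
    is a combination of four values of the form, and each of them lies between 0
    and twice the diagonal part; the factor 4 is the price of this. *)
Lemma psd2_bound p : SZ O p -> p c <= 4 * Num.sqrt (p a) * Num.sqrt (p b).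
Proof.
move=> pS; have [[pD pZ] pI _] := pS.
pose Q w := a + w *: c + w^* *: d + (w^* * w) *: b.
have Q0 w : zpos O (Q w).
  by have := abcd_psd 1 w; rewrite rmorph1 !(mul1r, mulr1) scale1r.
have p_real (r : R) x : 0 <= r -> p (r%:C *: x) = r * p x.
  by move=> r0; rewrite pZ normc_real.
have Q_le (r : R) w : w^* * w = (r ^+ 2)%:C ->
  p (Q w) <= 2 * p a + 2 * (r ^+ 2 * p b).
  move=> ww; apply: (@le_trans _ _ (p (2%:R%:C *: a + (2 * r ^+ 2)%:C *: b))).
    apply: pI; [exact/zle0|rewrite /zle].
    rewrite (_ : _ - _ = Q (- w))//.
    have two : (2%:R : R)%:C = 2%:R :> R[i]
      by exact: (rmorph_nat (real_complex R)).
    rewrite /Q rmorphN /= mulrNN ww !scaleNr real_complexM two -scalerA.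
    rewrite !scaler_nat !mulr2n.
    set B := _ *: b; set C := _ *: c; set D := _ *: d.
    by rewrite sub_flip_cross.
  rewrite (le_trans (pD _ _))// !p_real ?(mulr_ge0 _ (sqr_ge0 r))//.
  by rewrite mulrA.
have main (r : R) : 0 < r -> r * p c <= 2 * p a + 2 * (r ^+ 2 * p b).
  move=> r0; pose w : R[i] := r%:C; set M := leRHS.
  have QD z : Q z - Q (- z) = 2%:R *: (z *: c + z^* *: d).
    rewrite /Q rmorphN /= mulrNN !scaleNr scaler_nat mulr2n.
    set B := _ *: b; set C := _ *: c; set D := _ *: d.
    by rewrite sub_opp_cross.
  (* Polarization: the two differences carry the terms in c and d only, and the
     factor 'i makes those in d cancel. *)
  have cE : (4%:R * r)%:C *: c =
      Q w - Q (- w) - 'i%C *: (Q ('i%C * w) - Q (- ('i%C * w))).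
    rewrite !QD (conj_real r) [(_ * w)^*]rmorphM /= conj_i (conj_real r) mulNr
      scaleNr.
    have -> : 'i%C *: (2%:R *: (('i%C * w) *: c - ('i%C * w) *: d)) =
        - (2%:R *: (w *: c - w *: d)).
      rewrite -!(scalerA 'i%C w) -scalerBr !scalerA mulrAC mul_ii.
      by rewrite mulN1r scaleNr.
    rewrite opprK -scalerDr addrACA subrr addr0 -scalerDl scalerA.
    rewrite real_complexM (rmorph_nat (real_complex R)) -/w -mulr2n -(mulr_natl
      w).
    by rewrite mulrA -natrM.
  have ww z : z^* * z = 1 -> (z * w)^* * (z * w) = (r ^+ 2)%:C.
    move=> z1; rewrite rmorphM /= conj_real mulrACA z1 mul1r.
    by rewrite -real_complexM.
  have pN x : p (- x) = p x by rewrite seminormN.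
  have pi x : p ('i%C *: x) = p x.
    by rewrite pZ /normc /= expr0n expr1n add0r sqrtr1 mul1r.
  have : 4 * r * p c <= M + M + (M + M).
    rewrite -p_real ?mulr_ge0 ?(ltW r0)// cE.
    rewrite (le_trans (pD _ _))// lerD// ?pN ?pi (le_trans (pD _ _))// ?pN
      lerD// Q_le//.
    - by rewrite -[w]mul1r ww// rmorph1 mul1r.
    - by rewrite -mulN1r ww// rmorphN rmorph1 mulrNN mul1r.
    - by rewrite ww// conj_i mulNr mul_ii opprK.
    - by rewrite -mulNr ww// rmorphN /= conj_i opprK mulrN mul_ii opprK.
  by move=> h; lra.
have pa0 : 0 <= p a by apply: SZ_ge0 pS.
have pb0 : 0 <= p b by apply: SZ_ge0 pS.
have [a0|a0] := eqVneq (p a) 0.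
  rewrite a0 sqrtr0 mulr0 mul0r; apply: (@ler_forall_addM _ _ _ (2 * p b)) => r
    r0.
  have := main r r0; rewrite a0 mulr0 !add0r => h.
  by rewrite -(ler_pM2l r0) (_ : r * (_ * r) = 2 * (r ^+ 2 * p b))//; ring.
have {}a0 : 0 < p a by rewrite lt_neqAle eq_sym a0.
have [b0|b0] := eqVneq (p b) 0.
  rewrite b0 sqrtr0 mulr0; apply: (@ler_forall_addM _ _ _ (2 * p a)) => r r0.
  have rV0 : 0 < r^-1 by rewrite invr_gt0.
  have := main _ rV0; rewrite b0 !mulr0 addr0 add0r => h.
  by rewrite -(ler_pM2l rV0) (_ : r^-1 * (_ * r) = 2 * p a)//; field;
    rewrite gt_eqF.
have {}b0 : 0 < p b by rewrite lt_neqAle eq_sym b0.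
set u := Num.sqrt (p a); set v := Num.sqrt (p b).
have u0 : 0 < u by rewrite sqrtr_gt0.
have v0 : 0 < v by rewrite sqrtr_gt0.
(* This ratio minimizes the bound 2 * p a / r + 2 * r * p b for p c. *)
have := main (u / v) (divr_gt0 u0 v0).
have -> : p a = u ^+ 2 by rewrite sqr_sqrtr.
have -> : p b = v ^+ 2 by rewrite sqr_sqrtr.
have -> : 2 * u ^+ 2 + 2 * ((u / v) ^+ 2 * v ^+ 2) = u / v * (4 * u * v).
  by field; rewrite gt_eqF.
by rewrite ler_pM2l// divr_gt0.
Qed.

End TwoByTwo.

(** * The topology of a gramian *)

Section GramTopology.
Variables (R : realType) (Z : tvsType R[i]) (O : ordered_star Z).
Variables (K : lmodType R[i]) (g : gramian O K).
Implicit Types (x y : K) (p q : Z -> R).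

(** The seminorms that define the topology of a VE-space. *)
Definition gramnorm p x : R := Num.sqrt (p (g x x)).

Lemma gramnorm_seminorm p : SZ O p -> is_seminorm (gramnorm p).
Proof. by move=> pS; apply: (@gram_seminormP _ _ _ _ g); exists p. Qed.

Lemma gramnorm_le p q x : (forall z, q z <= p z) ->
  gramnorm q x <= gramnorm p x.
Proof. by move=> qp; apply: ler_wsqrtr. Qed.

Lemma gramnorm_ge0 p x : 0 <= gramnorm p x. Proof. exact: sqrtr_ge0. Qed.

(** Finitely many seminorms are dominated by one because SZ is directed. *)
Lemma nbhs_gramnorm (x : vespace g) (U : set (vespace g)) :
  nbhs x U <->
  exists p e, [/\ SZ O p, 0 < e & forall y, gramnorm p (y - x) < e -> U y].
Proof.
split=> [[F [e [/finite_seqP[s ->] Fg e0 FU]]]|[p [e [pS e0 pU]]]]; last first.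
  exists [set gramnorm p], e; split=> //; first by move=> _ ->; exists p.
  by move=> y /(_ _ erefl); apply: pU.
have [p pS ps] : exists2 p, SZ O p & forall y, forall n, n \in s ->
  n y <= gramnorm p y.
  elim: s Fg {FU} => [|n s IH] sg; first by exists (fun=> 0) => //; exact: SZ0.
  have [|p pS ps] := IH; first by move=> m ms; apply: sg;
    rewrite /= inE ms orbT.
  have [q qS qE] : gram_seminorms g n by apply: sg; rewrite /= inE eqxx.
  exists (fun z => q z + p z); first exact: SZD.
  move=> y m; rewrite inE => /predU1P[->|ms].
    by rewrite -qE; apply: gramnorm_le => z; rewrite lerDl (SZ_ge0 _ pS).
  by apply: le_trans (ps y m ms) _; apply: gramnorm_le => z;
    rewrite lerDr (SZ_ge0 _ qS).
by exists p, e; split=> // y ye; apply: FU => n ns;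
  apply: le_lt_trans (ps _ _ ns) ye.
Qed.

(** In the nontrivial direction, a vector that violates the inequality is
    rescaled to have an image of norm one. *)
Lemma ve_continuousP (T : {linear K -> K}) :
  ve_continuous g T <-> forall p, SZ O p -> exists q c,
    [/\ SZ O q, 0 <= c & forall x, gramnorm p (T x) <= c * gramnorm q x].
Proof.
split=> [Tc p pS|H x U /nbhs_gramnorm[p [e [pS e0 pU]]]]; last first.
  have [q [c [qS c0 Tq]]] := H p pS; have c1 : 0 < c + 1 by rewrite ltr_wpDl.
  apply/nbhs_gramnorm; exists q, (e / (c + 1)); split=> //;
    first exact: divr_gt0.
  move=> y; rewrite ltr_pdivlMr// => ye; apply: pU; rewrite -raddfB.
  apply: le_lt_trans (Tq _) (le_lt_trans _ ye).
  by rewrite mulrC ler_wpM2l ?gramnorm_ge0// lerDl.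
have : nbhs (T 0 : vespace g) [set y | gramnorm p y < 1].
  by apply/nbhs_gramnorm; exists p, 1; split=> // y; rewrite raddf0 subr0.
move=> /(Tc (0 : vespace g))/nbhs_gramnorm[q [e [qS e0 qT]]].
have [qD qZ] := gramnorm_seminorm qS; have [pD pZ] := gramnorm_seminorm pS.
exists q, (2 / e); split=> // [|x]; first by rewrite divr_ge0// ltW.
rewrite leNgt; apply/negP => xlt.
have px0 : 0 < gramnorm p (T x).
  by apply: le_lt_trans xlt; rewrite mulr_ge0 ?gramnorm_ge0// divr_ge0// ltW.
have := qT ((gramnorm p (T x))^-1%:C *: x).
rewrite /= subr0 linearZ /= qZ pZ normc_real ?invr_ge0 ?gramnorm_ge0//.
rewrite mulVf ?gt_eqF// ltxx => H; suff : false by []; apply: H.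
rewrite mulrC ltr_pdivrMr//.
move: xlt; rewrite mulrAC ltr_pdivrMr// => xlt.
by rewrite mulrC; apply: le_lt_trans xlt;
  rewrite ler_peMl ?gramnorm_ge0// ler1n.
Qed.

End GramTopology.

(** * Finite combinations of kernel sections *)

Section Combinations.
Variables (R : realType) (Z : tvsType R[i]) (X : Type) (k : X -> X -> Z).
Implicit Types (u v w : seq (R[i] * X)) (f h : X -> Z) (c : R[i]).

(** A list of weighted points stands for the linear combination of the kernel
    sections at these points. Working with lists, on which sums and multiples
    are concatenation and rescaling, avoids choosing representations of
    functions. *)
Definition kcomb u : X -> Z := fun y => \sum_(e <- u) e.1 *: k y e.2.

(** The pairing of a combination with a function, as dictated by the reproducing
    property: conjugate linear in the weights. *)
Definition cform u f : Z := \sum_(e <- u) e.1^* *: f e.2.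

Definition cscale c u := [seq (c * e.1, e.2) | e <- u].

Lemma kcomb_nil : kcomb [::] = 0.
Proof. by apply/funext => y; rewrite /kcomb big_nil. Qed.

Lemma kcomb_cat u v : kcomb (u ++ v) = kcomb u + kcomb v.
Proof. by apply/funext => y; rewrite /kcomb big_cat. Qed.

Lemma kcomb_scale c u : kcomb (cscale c u) = c *: kcomb u.
Proof.
apply/funext => y; rewrite /kcomb big_map -[RHS]/(c *: kcomb u y) scaler_sumr.
by apply: eq_bigr => e _; rewrite scalerA.
Qed.

Lemma kcomb1 x : kcomb [:: (1, x)] = k^~ x.
Proof. by apply/funext => y; rewrite /kcomb big_seq1 scale1r. Qed.

Lemma cform_cat u v f : cform (u ++ v) f = cform u f + cform v f.
Proof. by rewrite /cform big_cat. Qed.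

Lemma cform_scale c u f : cform (cscale c u) f = c^* *: cform u f.
Proof.
rewrite /cform big_map scaler_sumr; apply: eq_bigr => e _ /=.
by rewrite rmorphM scalerA.
Qed.

Lemma cform1 x f : cform [:: (1, x)] f = f x.
Proof. by rewrite /cform big_seq1 rmorph1 scale1r. Qed.

Lemma cformD u f h : cform u (f + h) = cform u f + cform u h.
Proof.
by rewrite /cform -big_split; apply: eq_bigr => e _ /=; rewrite scalerDr.
Qed.

Lemma cformZ u c f : cform u (c *: f) = c *: cform u f.
Proof.
by rewrite /cform scaler_sumr; apply: eq_bigr => e _; rewrite !scalerA mulrC.
Qed.

Lemma cformN u f : cform u (- f) = - cform u f.
Proof. by rewrite -scaleN1r cformZ scaleN1r. Qed.

Lemma cformB u f h : cform u (f - h) = cform u f - cform u h.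
Proof. by rewrite cformD cformN. Qed.

Lemma cform0 u : cform u 0 = 0.
Proof. by have := cformB u 0 0; rewrite !subrr. Qed.

Lemma cform_sub u v f : cform (u ++ cscale (-1) v) f = cform u f - cform v f.
Proof. by rewrite cform_cat cform_scale rmorphN rmorph1 scaleN1r. Qed.

Lemma kcomb_sub u v : kcomb (u ++ cscale (-1) v) = kcomb u - kcomb v.
Proof. by rewrite kcomb_cat kcomb_scale scaleN1r. Qed.

Lemma kcomb_ord n (t : 'I_n -> R[i]) (x : 'I_n -> X) y :
  kcomb [seq (t j, x j) | j <- enum 'I_n] y = \sum_(j < n) t j *: k y (x j).
Proof. by rewrite /kcomb big_map big_enum. Qed.

Lemma cform_ord n (t : 'I_n -> R[i]) (x : 'I_n -> X) f :
  cform [seq (t j, x j) | j <- enum 'I_n] f = \sum_(j < n) (t j)^* *: f (x j).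
Proof. by rewrite /cform big_map big_enum. Qed.

(** Lists of weighted points are the indexed families over which the conditions
    on the kernel quantify. *)
Lemma seq_ord u : exists n (t : 'I_n -> R[i]) (x : 'I_n -> X),
  u = [seq (t j, x j) | j <- enum 'I_n].
Proof.
exists (size u).
exists (fun j => (tnth (in_tuple u) j).1), (fun j => (tnth (in_tuple u) j).2).
rewrite -[LHS](map_tnth_enum (in_tuple u)).
by apply: eq_map => j; rewrite -surjective_pairing.
Qed.

End Combinations.

(** * The dual norm and the functions it approximates *)

Section DualNorm.
Variables (R : realType) (Z : tvsType R[i]) (O : ordered_star Z).
Variables (X : Type) (k : X -> X -> Z).
Hypothesis Zadm : admissible O.
Hypothesis kpsd : weakly_psd O k.
Implicit Types (u v w : seq (R[i] * X)) (f h : X -> Z) (c : R[i]).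
Implicit Types (p q : Z -> R).

Lemma cform_kcomb_psd u : zpos O (cform u (kcomb k u)).
Proof.
have [n [t [x ->]]] := seq_ord u.
have := kpsd x t; rewrite zle0; congr (zpos O _).
rewrite cform_ord exchange_big; apply: eq_bigr => l _.
by rewrite kcomb_ord scaler_sumr; apply: eq_bigr => j _; rewrite scalerA.
Qed.

Lemma cform_kcomb_psd2 u v (s t : R[i]) :
  zpos O ((s^* * s) *: cform u (kcomb k u) + (s^* * t) *: cform u (kcomb k v)
    + (t^* * s) *: cform v (kcomb k u) + (t^* * t) *: cform v (kcomb k v)).
Proof.
have := cform_kcomb_psd (cscale s u ++ cscale t v); congr (zpos O _).
rewrite kcomb_cat !kcomb_scale cform_cat !cform_scale !cformD !cformZ.
by rewrite !scalerDr !scalerA !addrA.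
Qed.

(** By positivity the kernel is Hermitian. *)
Lemma cform_kcombC u v : cform v (kcomb k u) = zstar O (cform u (kcomb k v)).
Proof. exact: psd2_hermitian (cform_kcomb_psd2 u v). Qed.

Lemma psd_hermitian : hermitian_kernel O k.
Proof.
move=> x y; have := cform_kcombC [:: (1, y)] [:: (1, x)].
by rewrite !kcomb1 !cform1.
Qed.

Definition cnorm p u : R := Num.sqrt (p (cform u (kcomb k u))).

Lemma cnorm_ge0 p u : 0 <= cnorm p u. Proof. exact: sqrtr_ge0. Qed.

Lemma cform_bound p u v : SZ O p ->
  p (cform u (kcomb k v)) <= 4 * cnorm p u * cnorm p v.
Proof. by move=> pS; exact: (psd2_bound (cform_kcomb_psd2 u v) pS). Qed.

(** The function f has norm at most e as a functional on combinations, for p and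
    for all smaller seminorms. Quantifying over the smaller seminorms makes the
    notion monotone in p, which the inequality for p alone would not be. By
    Cauchy-Schwarz it agrees with cnorm on combinations up to the factor 4, yet
    it makes sense for every function. *)
Definition dual_bound p (e : R) f :=
  forall q, SZ O q -> (forall z, q z <= p z) ->
  forall u, q (cform u f) <= e * cnorm q u.

Lemma cnorm_le p q u : (forall z, q z <= p z) -> cnorm q u <= cnorm p u.
Proof. by move=> qp; apply: ler_wsqrtr. Qed.

Lemma dual_bound_le p q e f : (forall z, q z <= p z) ->
  dual_bound p e f -> dual_bound q e f.
Proof.
by move=> qp H r rS rq u; apply: H => // z; apply: le_trans (rq z) _.
Qed.

Lemma dual_bound_weaken p (e d : R) f : e <= d ->
  dual_bound p e f -> dual_bound p d f.
Proof.
move=> ed H q qS qp u; apply: le_trans (H q qS qp u) _.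
by rewrite ler_wpM2r ?cnorm_ge0.
Qed.

Lemma dual_bound0 p (e : R) : 0 <= e -> dual_bound p e 0.
Proof.
move=> e0 q [qS _ _] _ u; rewrite cform0 seminorm0//.
by rewrite mulr_ge0 ?cnorm_ge0.
Qed.

Lemma dual_boundD p (e d : R) f h :
  dual_bound p e f -> dual_bound p d h -> dual_bound p (e + d) (f + h).
Proof.
move=> H1 H2 q qS qp u; rewrite cformD mulrDl.
have [[qD _] _ _] := qS; apply: le_trans (qD _ _) _.
by rewrite lerD ?H1 ?H2.
Qed.

Lemma dual_boundZ p (e : R) c f :
  dual_bound p e f -> dual_bound p (normc c * e) (c *: f).
Proof.
move=> H q qS qp u; have [[_ qZ] _ _] := qS.
by rewrite cformZ qZ -mulrA ler_wpM2l ?normc_ge0 ?H.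
Qed.

Lemma dual_boundN p (e : R) f : dual_bound p e f -> dual_bound p e (- f).
Proof.
move=> H q qS qp u; have [qs _ _] := qS.
by rewrite cformN seminormN ?H.
Qed.

Lemma dual_boundB p (e d : R) f h :
  dual_bound p e f -> dual_bound p d h -> dual_bound p (e + d) (f - h).
Proof. by move=> H1 /dual_boundN; apply: dual_boundD. Qed.

Lemma dual_bound_kcomb p u : dual_bound p (4 * cnorm p u) (kcomb k u).
Proof.
move=> q qS qp v; apply: le_trans (cform_bound _ _ qS) _.
rewrite mulrAC ler_wpM2r ?cnorm_ge0// ler_wpM2l// cnorm_le//.
Qed.

(** Testing the functional on the combination itself. *)
Lemma cnorm_dual_bound p (e : R) u : SZ O p -> 0 <= e ->
  dual_bound p e (kcomb k u) -> cnorm p u <= e.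
Proof.
move=> pS e0 /(_ p pS (fun=> lexx _) u).
have p0 : 0 <= p (cform u (kcomb k u)) by exact: SZ_ge0 pS.
rewrite -[leLHS]sqr_sqrtr// -/(cnorm p u) => H.
have [->//|n0] := eqVneq (cnorm p u) 0.
have {}n0 : 0 < cnorm p u by rewrite lt_neqAle eq_sym n0 cnorm_ge0.
by rewrite expr2 ler_pM2r in H.
Qed.

(** The closure of the combinations in the dual norm. This is the completion of
    the space of combinations, realized inside the space of functions. *)
Definition approximable f := forall p (e : R), SZ O p -> 0 < e ->
  exists u, dual_bound p e (f - kcomb k u).

Lemma approximable_kcomb u : approximable (kcomb k u).
Proof. by move=> p e _ e0; exists u; rewrite subrr; apply/dual_bound0/ltW. Qed.

Lemma approximable_lin c f h :
  approximable f -> approximable h -> approximable (c *: f + h).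
Proof.
move=> fA hA p e pS e0.
have c0 : 0 < normc c + 1 by rewrite ltr_wpDl ?normc_ge0.
have e20 : 0 < e / 2 by rewrite divr_gt0.
have [u Hu] := fA p _ pS (divr_gt0 e20 c0); have [v Hv] := hA p _ pS e20.
exists (cscale c u ++ v); rewrite kcomb_cat kcomb_scale opprD addrACA -scalerBr.
rewrite (splitr e); apply: dual_boundD Hv.
apply: dual_bound_weaken (dual_boundZ c Hu).
by rewrite mulrA ler_pdivrMr// mulrC ler_wpM2l ?(ltW e20)// lerDl.
Qed.

Lemma approximable_sub f h : approximable f -> approximable h ->
  approximable (f - h).
Proof. by move=> fA hA; rewrite -scaleN1r addrC; apply: approximable_lin. Qed.

Lemma approximable_bounded f p : approximable f -> SZ O p ->
  exists2 C : R, 0 <= C & dual_bound p C f.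
Proof.
move=> fA pS; have [u Hu] := fA p 1 pS ltr01.
exists (1 + 4 * cnorm p u); first by rewrite addr_ge0 ?mulr_ge0 ?cnorm_ge0.
by rewrite -(subrK (kcomb k u) f); apply: dual_boundD Hu _;
  exact: dual_bound_kcomb.
Qed.

(** The element z is the limit of cform u h as the combination u tends to f. *)
Definition pairing_spec f h z :=
  forall p (C d : R) u, SZ O p -> 0 <= C -> 0 <= d ->
  dual_bound p C h -> dual_bound p d (f - kcomb k u) ->
  p (z - cform u h) <= C * d.

(** Two combinations close to f are close to each other, by the triangle
    inequality for the dual norm. *)
Lemma cform_diff_bound p (C d e : R) f h u v :
  SZ O p -> 0 <= C -> 0 <= d -> 0 <= e ->
  dual_bound p C h -> dual_bound p d (f - kcomb k u) ->
  dual_bound p e (f - kcomb k v) -> p (cform u h - cform v h) <= C * (d + e).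
Proof.
move=> pS C0 d0 e0 Ch ud ve; rewrite -cform_sub.
apply: le_trans (Ch p pS (fun=> lexx _) _) _; rewrite ler_wpM2l//.
apply: cnorm_dual_bound => //; first by rewrite addr_ge0.
rewrite kcomb_sub.
have -> : kcomb k u - kcomb k v = (f - kcomb k v) - (f - kcomb k u).
  by rewrite opprB [RHS]addrC addrA subrK.
by rewrite [d + e]addrC; apply: dual_boundB.
Qed.

(** The values at combinations that approximate f generate a Cauchy filter, and
    Z is complete. *)
Lemma pairing_exists f h : approximable f -> approximable h ->
  exists z, pairing_spec f h z.
Proof.
move=> fA hA.
pose B p (e : R) :=
  [set z | exists2 u, dual_bound p e (f - kcomb k u) & z = cform u h].
pose F : set_system Z :=
  [set A | exists p (e : R), [/\ SZ O p, 0 < e & B p e `<=` A]].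
have FP : ProperFilter F.
  apply: Build_ProperFilter_ex.
    move=> A [p [e [pS e0 BA]]]; have [u Hu] := fA p e pS e0.
    by exists (cform u h); apply: BA; exists u.
  split.
  - by exists (fun=> 0), 1; split=> //; exact: SZ0.
  - move=> A A' [p [e [pS e0 BA]]] [p' [e' [pS' e0' BA']]].
    exists (fun z => p z + p' z), (Num.min e e'); split.
    + exact: SZD.
    + by rewrite lt_min e0.
    + move=> z [u Hu ->]; split; [apply: BA|apply: BA']; exists u => //.
        apply: dual_bound_weaken (dual_bound_le _ Hu);
          first by rewrite ge_min lexx.
        by move=> t; rewrite lerDl (SZ_ge0 _ pS').
      apply: dual_bound_weaken (dual_bound_le _ Hu);
        first by rewrite ge_min lexx orbT.
      by move=> t; rewrite lerDr (SZ_ge0 _ pS).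
  - by move=> A A' AA' [p [e [pS e0 BA]]]; exists p, e; split=> // z /BA/AA'.
have [Ztop Zc] := Zadm.
have Fc : cauchy_filter F.
  move=> U /(nbhs0_SZ Ztop)[p pS pU].
  have [C C0 HC] := approximable_bounded hA pS.
  have C1 : 0 < C + 1 by rewrite ltr_wpDl.
  (* Chosen so that the bound C * (e + e) is smaller than 1. *)
  pose e := (C + 1)^-1 / 2 / 2.
  have e0 : 0 < e by rewrite !divr_gt0// invr_gt0.
  exists (B p e); first by exists p, e; split.
  move=> _ _ [u Hu ->] [v Hv ->]; apply: pU.
  apply: le_lt_trans (cform_diff_bound pS C0 (ltW e0) (ltW e0) HC Hu Hv) _.
  have : e * (C + 1) = 1 / 4 by rewrite /e; field; rewrite gt_eqF.
  nra.
have [z Fz] := Zc F FP Fc.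
exists z => p C d u pS C0 d0 HC Hu.
apply: (@ler_forall_addM _ _ _ (1 + C)) => e e0.
have : F [set y | p (z - y) < e] by exact: ((@cvg_SZ _ _ _ Ztop F z _).2 Fz).
case=> q [e' [qS e'0 qB]].
have pqS := SZD pS qS.
have ee0 : 0 < Num.min e e' by rewrite lt_min e0.
have [v Hv] := fA _ _ pqS ee0.
have Hvp : dual_bound p e (f - kcomb k v).
  apply: dual_bound_weaken (dual_bound_le _ Hv); first by rewrite ge_min lexx.
  by move=> t; rewrite lerDl (SZ_ge0 _ qS).
have Hvq : dual_bound q e' (f - kcomb k v).
  apply: dual_bound_weaken (dual_bound_le _ Hv);
    first by rewrite ge_min lexx orbT.
  by move=> t; rewrite lerDr (SZ_ge0 _ pS).
have h1 : p (z - cform v h) < e by apply: qB; exists v.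
have h2 := cform_diff_bound pS C0 (ltW e0) d0 HC Hvp Hu.
have [[pD _] _ _] := pS; have := pD (z - cform v h) (cform v h - cform u h).
rewrite addrA subrK => h3; nra.
Qed.

End DualNorm.

(** * The gramian of approximable functions *)

Section Pairing.
Variables (R : realType) (Z : tvsType R[i]) (O : ordered_star Z).
Variables (X : Type) (k : X -> X -> Z).
Hypothesis Zadm : admissible O.
Hypothesis kpsd : weakly_psd O k.
Implicit Types (u v w : seq (R[i] * X)) (f h : X -> Z) (c : R[i]).
Implicit Types (p q : Z -> R).

Local Notation approximable := (approximable O k).
Local Notation dual_bound := (dual_bound O k).
Local Notation kcomb := (kcomb k).

Definition pairing f h : Z := xget 0 [set z | pairing_spec O k f h z].

Lemma pairingP f h : approximable f -> approximable h ->
  pairing_spec O k f h (pairing f h).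
Proof.
move=> fA hA; have [z zP] := pairing_exists Zadm kpsd fA hA.
by rewrite /pairing; case: xgetP => [_ -> //|/(_ z)].
Qed.

(** To identify a pairing it is enough to approximate f arbitrarily well by some
    combinations of one's own choice. *)
Lemma pairing_unique f h z : approximable f -> approximable h ->
  (forall p, SZ O p -> exists C, forall d, 0 < d ->
     exists2 u, dual_bound p d (f - kcomb u) & p (z - cform u h) <= C * d) ->
  z = pairing f h.
Proof.
move=> fA hA H; apply/eqP; rewrite -subr_eq0; apply/eqP.
apply: (SZ_separates Zadm.1) => p pS.
have [C1 HC1] := H p pS.
have [C C0 HC] := approximable_bounded kpsd hA pS.
apply: (@ler_forall_addM _ _ _ (C1 + C)) => d d0; have [u Hu h1] := HC1 d d0.
have := pairingP fA hA pS C0 (ltW d0) HC Hu.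
rewrite -seminormN; last by case: pS.
rewrite opprB => h2.
have [[pD _] _ _] := pS; have := pD (z - cform u h) (cform u h - pairing f h).
rewrite addrA subrK => h3; lra.
Qed.

Lemma pairing_linear f h1 h2 c :
  approximable f -> approximable h1 -> approximable h2 ->
  pairing f (c *: h1 + h2) = c *: pairing f h1 + pairing f h2.
Proof.
move=> fA h1A h2A; apply/esym/pairing_unique => //;
  first exact: approximable_lin.
move=> p pS; have [[pD pZ] _ _] := pS.
have [C1 C10 HC1] := approximable_bounded kpsd h1A pS.
have [C2 C20 HC2] := approximable_bounded kpsd h2A pS.
exists (normc c * C1 + C2) => d d0; have [u Hu] := fA p d pS d0; exists u => //.
rewrite cformD cformZ opprD addrACA -scalerBr; apply: le_trans (pD _ _) _.
rewrite mulrDl lerD//; last exact: (pairingP fA h2A pS C20 (ltW d0) HC2 Hu).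
rewrite pZ -mulrA ler_wpM2l ?normc_ge0//.
exact: (pairingP fA h1A pS C10 (ltW d0) HC1 Hu).
Qed.

Lemma pairing_kcomb u h : approximable h -> pairing (kcomb u) h = cform u h.
Proof.
move=> hA; apply/esym/pairing_unique => //; first exact: approximable_kcomb.
move=> p pS; exists 1 => d d0; exists u.
  by rewrite subrr; apply/dual_bound0/ltW.
by have [pn _ _] := pS; rewrite subrr (seminorm0 pn) mul1r ltW.
Qed.

(** Both arguments are approximated at once; d <= 1 keeps the quadratic part of
    the error below a multiple of d. *)
Lemma pairing_approx2 p (C C' d : R) f h u v :
  approximable f -> approximable h ->
  SZ O p -> 0 <= C -> 0 <= C' -> 0 <= d -> d <= 1 ->
  dual_bound p C f -> dual_bound p C' h ->
  dual_bound p d (f - kcomb u) -> dual_bound p d (h - kcomb v) ->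
  p (pairing f h - cform u (kcomb v)) <= (C + C' + 1) * d.
Proof.
move=> fA hA pS C0 C0' d0 d1 HC HC' Hu Hv.
have h1 := pairingP fA hA pS C0' d0 HC' Hu.
have h2 := Hv p pS (fun=> lexx _) u.
have h3 : cnorm k p u <= C + d.
  apply: (cnorm_dual_bound pS); first by rewrite addr_ge0.
  by rewrite -(subKr f (kcomb u)); apply: dual_boundB.
have h4 := cnorm_ge0 k p u.
have [[pD _] _ _] := pS.
have := pD (pairing f h - cform u h) (cform u h - cform u (kcomb v)).
rewrite addrA subrK -cformB => h5; nra.
Qed.

(** Positivity holds for combinations and survives in the limit because the cone
    is closed. *)
Lemma pairing_psd2 f h (s t : R[i]) : approximable f -> approximable h ->
  zpos O ((s^* * s) *: pairing f f + (s^* * t) *: pairing f h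
    + (t^* * s) *: pairing h f + (t^* * t) *: pairing h h).
Proof.
move=> fA hA; apply: (zpos_SZ_closed Zadm.1) => p e pS e0.
have [[pD pZ] _ _] := pS.
have [C C0 HC] := approximable_bounded kpsd fA pS.
have [C' C'0 HC'] := approximable_bounded kpsd hA pS.
pose M := normc (s^* * s) + normc (s^* * t) + normc (t^* * s) + normc (t^* * t).
have M0 : 0 <= M by rewrite !addr_ge0 ?normc_ge0.
pose L := 2 * C + 2 * C' + 1.
have L0 : 0 < L by rewrite /L; lra.
have [la lb lc ld] :
  [/\ C + C + 1 <= L, C + C' + 1 <= L, C' + C + 1 <= L & C' + C' + 1 <= L].
  by rewrite /L; split; lra.
clearbody L.
have ML : 0 < M * L + 1 by rewrite ltr_wpDl// mulr_ge0// ltW.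
pose d := Num.min 1 (e / (M * L + 1)).
have d0 : 0 < d by rewrite lt_min ltr01 divr_gt0.
have d1 : d <= 1 by rewrite ge_min lexx.
have [u Hu] := fA p d pS d0; have [v Hv] := hA p d pS d0.
exists ((s^* * s) *: cform u (kcomb u) + (s^* * t) *: cform u (kcomb v)
    + (t^* * s) *: cform v (kcomb u) + (t^* * t) *: cform v (kcomb v)).
  exact: cform_kcomb_psd2.
have H x y a : p (x - y) <= L * d -> p (a *: x - a *: y) <= normc a * (L * d).
  by move=> xy; rewrite -scalerBr pZ ler_wpM2l ?normc_ge0.
have dL (a b : R) : a <= b -> a * d <= b * d.
  by move=> ab; rewrite ler_wpM2r ?(ltW d0).
apply: (@le_lt_trans _ _ (M * (L * d))).
  rewrite /M !mulrDl.
  have sub4 (a1 a2 a3 a4 b1 b2 b3 b4 : Z) :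
      a1 + a2 + a3 + a4 - (b1 + b2 + b3 + b4) =
      (a1 - b1) + (a2 - b2) + (a3 - b3) + (a4 - b4).
    by do 3 (rewrite opprD addrACA; congr (_ + _)).
  rewrite sub4; apply: le_trans (pD _ _) (lerD _ _).
    apply: le_trans (pD _ _) (lerD _ _).
      apply: le_trans (pD _ _) (lerD _ _).
  - apply: H => //.
    apply: le_trans _ (dL _ _ la).
    exact: (pairing_approx2 fA fA pS C0 C0 (ltW d0) d1 HC HC Hu Hu).
  - apply: H => //.
    apply: le_trans _ (dL _ _ lb).
    exact: (pairing_approx2 fA hA pS C0 C'0 (ltW d0) d1 HC HC' Hu Hv).
  - apply: H => //.
    apply: le_trans _ (dL _ _ lc).
    exact: (pairing_approx2 hA fA pS C'0 C0 (ltW d0) d1 HC' HC Hv Hu).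
  - apply: H => //.
    apply: le_trans _ (dL _ _ ld).
    exact: (pairing_approx2 hA hA pS C'0 C'0 (ltW d0) d1 HC' HC' Hv Hv).
have : d <= e / (M * L + 1) by rewrite ge_min lexx orbT.
rewrite ler_pdivlMr// => dle; nra.
Qed.

Lemma pairing_star f h : approximable f -> approximable h ->
  pairing f h = zstar O (pairing h f).
Proof. by move=> fA hA; apply: psd2_hermitian => s t; apply: pairing_psd2. Qed.

Lemma pairing_ge0 f : approximable f -> zpos O (pairing f f).
Proof.
move=> fA; have := pairing_psd2 1 0 fA fA.
by rewrite !(rmorph1, rmorph0, mul0r, mulr0, mul1r, scale0r, scale1r, addr0).
Qed.

Lemma pairing_bound p f h : approximable f -> approximable h -> SZ O p ->
  p (pairing f h) <=
    4 * Num.sqrt (p (pairing f f)) * Num.sqrt (p (pairing h h)).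
Proof.
move=> fA hA pS; apply: (psd2_bound _ pS) => s t;
  exact: (pairing_psd2 s t fA hA).
Qed.

(** By Cauchy-Schwarz a null vector pairs to 0 with every kernel section, and
    these pairings are its values. *)
Lemma pairing_eq0 f : approximable f -> pairing f f = 0 -> f = 0.
Proof.
move=> fA ff0; apply/funext => x; apply: (SZ_separates Zadm.1) => p pS.
have xA : approximable (kcomb [:: (1, x)]) by exact: approximable_kcomb.
have := pairing_bound xA fA pS.
rewrite pairing_kcomb// cform1 ff0 => /le_trans; apply.
by have [pn _ _] := pS; rewrite (seminorm0 pn) sqrtr0 mulr0.
Qed.

Lemma dual_bound_pairing p f : approximable f ->
  dual_bound p (4 * Num.sqrt (p (pairing f f))) f.
Proof.
move=> fA q qS qp u; have uA : approximable (kcomb u)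
  by exact: approximable_kcomb.
rewrite -pairing_kcomb//; apply: le_trans (pairing_bound uA fA qS) _.
rewrite pairing_kcomb// -/(cnorm k q u) mulrAC ler_wpM2r ?cnorm_ge0//.
by rewrite ler_wpM2l// ler_wsqrtr.
Qed.

(** With dual_bound_pairing this shows that the dual norm and the norm of the
    gramian are equivalent on approximable functions. *)
Lemma pairing_dual_bound p (e : R) f : approximable f -> SZ O p -> 0 <= e ->
  dual_bound p e f -> Num.sqrt (p (pairing f f)) <= e.
Proof.
move=> fA pS e0 He.
rewrite -[leRHS](ger0_norm e0) -sqrtr_sqr ler_wsqrtr//.
apply: (@ler_forall_addM _ _ _ (2 * e)) => d d0; have [u Hu] := fA p d pS d0.
have h1 := pairingP fA fA pS e0 (ltW d0) He Hu.
have h2 := He p pS (fun=> lexx _) u.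
have h3 : cnorm k p u <= e + d.
  apply: (cnorm_dual_bound pS); first by rewrite addr_ge0 // ltW.
  by rewrite -(subKr f (kcomb u)); apply: dual_boundB.
have [[pD _] _ _] := pS; have := pD (pairing f f - cform u f) (cform u f).
rewrite subrK => h5; nra.
Qed.

End Pairing.

(** * The reproducing kernel space *)

Section SpaceType.
Variables (R : realType) (Z : tvsType R[i]) (O : ordered_star Z).
Variables (X : Type) (k : X -> X -> Z).

Definition rk_pred : {pred X -> Z} := [pred f | `[< approximable O k f >]].

Lemma rk_predP f : reflect (approximable O k f) (f \in rk_pred).
Proof. exact: asboolP. Qed.

Lemma rk_pred_submod : submod_closed rk_pred.
Proof.
split=> [|c f h /rk_predP fA /rk_predP hA]; apply/rk_predP.
  by rewrite -(kcomb_nil k); apply: approximable_kcomb.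
exact: approximable_lin.
Qed.

HB.instance Definition _ :=
  GRing.isSubmodClosed.Build R[i] (X -> Z) rk_pred rk_pred_submod.

Record rkspace := RKSpace { rkval : X -> Z; rkvalP : rkval \in rk_pred }.

HB.instance Definition _ := [isSub for rkval].
HB.instance Definition _ := [Choice of rkspace by <:].
HB.instance Definition _ := [SubChoice_isSubLmodule of rkspace by <:].

End SpaceType.

Section Space.
Variables (R : realType) (Z : tvsType R[i]) (O : ordered_star Z).
Variables (X : Type) (k : X -> X -> Z).
Hypothesis Zadm : admissible O.
Hypothesis kpsd : weakly_psd O k.
Local Notation S := (rkspace O k).

Lemma rkA (f : S) : approximable O k (\val f).
Proof. exact/rk_predP/valP. Qed.

Definition rk_gram (f h : S) : Z := pairing O k (\val f) (\val h).

Lemma rk_gram_linear f : linear (rk_gram f).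
Proof.
move=> c h1 h2; rewrite /rk_gram linearP.
by apply: pairing_linear => //; apply: rkA.
Qed.

Lemma rk_gram_star f h : rk_gram f h = zstar O (rk_gram h f).
Proof. by apply: pairing_star => //; apply: rkA. Qed.

Lemma rk_gram_ge0 f : zle O 0 (rk_gram f f).
Proof. by apply/zle0; apply: pairing_ge0 => //; apply: rkA. Qed.

Lemma rk_gram_eq0 f : rk_gram f f = 0 <-> f = 0.
Proof.
split=> [|->]; last by have := rk_gram_linear 0 (-1) 0 0;
  rewrite scaler0 addr0 scaleN1r addNr.
move=> /(pairing_eq0 Zadm kpsd (rkA f)) f0; apply: val_inj.
by rewrite raddf0.
Qed.

Definition rk_gramian : gramian O S :=
  Gramian rk_gram_linear rk_gram_star rk_gram_ge0 rk_gram_eq0.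

Local Notation N := (gramnorm rk_gramian).

Lemma rk_dual_bound p (f : S) : dual_bound O k p (4 * N p f) (\val f).
Proof. by apply: dual_bound_pairing => //; apply: rkA. Qed.

Lemma rk_norm_le p (e : R) (f : S) : SZ O p -> 0 <= e ->
  dual_bound O k p e (\val f) -> N p f <= e.
Proof. by move=> pS e0; apply: pairing_dual_bound => //; apply: rkA. Qed.

Definition rk_of u : S :=
  RKSpace (introT (rk_predP O k _) (@approximable_kcomb _ _ O _ k u)).

Lemma rk_of_form u (f : S) : rk_gramian (rk_of u) f = cform u (\val f).
Proof. by apply: pairing_kcomb => //; apply: rkA. Qed.

Lemma rk_dense (f : S) p (e : R) : SZ O p -> 0 < e ->
  exists u, N p (f - rk_of u) < e.
Proof.
move=> pS e0; have e20 : 0 < e / 2 by rewrite divr_gt0.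
have [u Hu] := rkA f pS e20; exists u; apply: (@le_lt_trans _ _ (e / 2)).
  by apply: rk_norm_le => //; exact: ltW.
by rewrite ltr_pdivrMr// ltr_pMr// ltr1n.
Qed.

(** Values at points are continuous, so a Cauchy filter converges pointwise. The
    dual norm is a supremum of functions of finitely many values, hence bounds
    on differences within the filter pass to the pointwise limit; therefore the
    limit is approximable and is the limit for the gramian as well. *)
Lemma rk_complete : vh_space rk_gramian.
Proof.
move=> F FF Fc; have [Ztop Zc] := Zadm.
have FiF : Filter (F : set_system S) by exact: filter_filter.
have Fsmall p (e : R) : SZ O p -> 0 < e ->
    exists2 A : set S, F A & forall f h, A f -> A h -> N p (f - h) < e.
  move=> pS e0.
  have : nbhs (0 : vespace rk_gramian) [set f : S | N p f < e].
    by apply/nbhs_gramnorm; exists p, e; split=> // y; rewrite subr0.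
  by move=> /Fc[A FA AA]; exists A.
have Feval x : exists z : Z, (fun f : S => \val f x) @ F --> z.
  suff Fx : cauchy_filter ((fun f : S => \val f x) @ F) by exact: Zc Fx.
  move=> U /(nbhs0_SZ Ztop)[p pS pU].
  have c0 := cnorm_ge0 k p [:: (1, x)]; set c := cnorm _ _ _ in c0.
  have c1 : 0 < 4 * c + 1 by lra.
  have cV0 : 0 < (4 * c + 1)^-1 by rewrite invr_gt0.
  have [A FA AA] := Fsmall p _ pS cV0.
  exists ((fun f : S => \val f x) @` A).
    by apply: (@filterS _ F _ A) => // f Af; exists f.
  move=> _ _ [f Af <-] [h Ah <-]; apply: pU.
  have := rk_dual_bound (f - h) pS (fun=> lexx _) [:: (1, x)].
  rewrite cform1 -/c raddfB => /le_lt_trans; apply.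
  have := AA _ _ Af Ah; set n := N p _ => nlt.
  have n0 : 0 <= n by exact: gramnorm_ge0.
  move: nlt; rewrite -[ltRHS]mul1r ltr_pdivlMr// => nlt; nra.
have {Feval}[l Hl] := choice Feval.
have Fform u p (e : R) : SZ O p -> 0 < e ->
    F [set f : S | p (cform u (l - \val f)) < e].
  move=> pS; elim: u e => [|[s x] u IH] e e0.
    apply: filterE => f; rewrite /= /cform big_nil.
    by have [pn _ _] := pS; rewrite (seminorm0 pn).
  have s1 : 0 < normc s + 1 by rewrite ltr_wpDl ?normc_ge0.
  have e20 : 0 < e / 2 by rewrite divr_gt0.
  have h1 : F [set f : S | p (l x - \val f x) < e / 2 / (normc s + 1)].
    exact: ((@cvg_SZ _ _ _ Ztop _ (l x) _).2 (Hl x) p _ pS (divr_gt0 e20 s1)).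
  have h2 := IH _ e20.
  apply: (@filterS2 S F FiF) h1 h2 => f /=; rewrite ltr_pdivlMr// => h1 h2.
  rewrite /cform big_cons /= -/(cform u (l - \val f)).
  have [[pD pZ] _ _] := pS; apply: le_lt_trans (pD _ _) _.
  rewrite (splitr e); apply: ler_ltD h2.
  rewrite pZ normc_conj; apply: le_trans (ltW h1).
  by rewrite mulrC ler_wpM2l ?(SZ_ge0 _ pS)// lerDl.
have Fbound p (e : R) : SZ O p -> 0 < e ->
    exists2 A : set S, F A & forall f, A f -> dual_bound O k p e (l - \val f).
  move=> pS e0; have e40 : 0 < e / 4 by rewrite divr_gt0.
  have [A FA AA] := Fsmall p _ pS e40; exists A => // f Af q qS qp u.
  apply: (@ler_forall_addM _ _ _ 1) => d d0.
  have : F (A `&` [set h : S | q (cform u (l - \val h)) < d]).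
    by apply: filterI => //; exact: Fform.
  case/(@filter_ex _ _ FF) => h [Ah /= hd].
  have := rk_dual_bound (h - f) qS qp u.
  have [[qD _] _ _] := qS.
  have := qD (cform u (l - \val h)) (cform u (\val h - \val f)).
  rewrite -cformD addrA subrK raddfB => h1 h2.
  have h3 := AA _ _ Ah Af.
  have c0 := cnorm_ge0 k q u.
  have : 4 * N p (h - f) * cnorm k q u <= e * cnorm k q u.
    by rewrite ler_wpM2r//; lra.
  by move=> h4; lra.
have lA : approximable O k l.
  move=> p e pS e0; have e20 : 0 < e / 2 by rewrite divr_gt0.
  have [A FA AA] := Fbound p _ pS e20; have [f Af] := @filter_ex _ _ FF _ FA.
  have [u Hu] := rkA f pS e20; exists u.
  have -> : l - kcomb k u = (l - \val f) + (\val f - kcomb k u)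
    by rewrite addrA subrK.
  by rewrite (splitr e); apply: dual_boundD => //; exact: AA.
pose L : S := RKSpace (introT (rk_predP O k _) lA).
exists L => U /nbhs_gramnorm[p [e [pS e0 pU]]].
have e20 : 0 < e / 2 by rewrite divr_gt0.
have [A FA AA] := Fbound p _ pS e20.
apply: filterS FA => f Af; apply: pU.
apply: (@le_lt_trans _ _ (e / 2));
  last by rewrite ltr_pdivrMr// ltr_pMr// ltr1n.
apply: rk_norm_le => //; first exact: ltW.
by rewrite raddfB -opprB; apply: dual_boundN; exact: AA.
Qed.

End Space.

(** * The semigroup acts by composition *)

Section Shift.
Variables (R : realType) (Z : tvsType R[i]) (O : ordered_star Z).
Variables (X : Type) (k : X -> X -> Z).
Variables (G : semigroupType) (star : star_semigroup G) (a : action_on G X).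
Hypothesis Zadm : admissible O.
Hypothesis kpsd : weakly_psd O k.
Hypothesis kinv : invariant_kernel k star a.
Hypothesis kbnd : bounded_shifts O k a.
Implicit Types (u v : seq (R[i] * X)) (f h : X -> Z) (p q : Z -> R) (xi : G).

Local Notation S := (rkspace O k).
Local Notation g := (rk_gramian Zadm kpsd).
Local Notation N := (gramnorm g).

(** On kernel sections the representation is prescribed: the section at x goes
    to the section at a xi x. *)
Definition cshift xi u := [seq (e.1, a xi e.2) | e <- u].

Lemma cform_shift xi u f : cform (cshift xi u) f = cform u (f \o a xi).
Proof. by rewrite /cform big_map. Qed.

(** Invariance of the kernel turns the prescribed action on combinations into
    composition with the action of the adjoint of xi, which makes sense for all
    functions. *)
Lemma kcomb_shift xi u : kcomb k (cshift xi u) = kcomb k u \o a (star xi).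
Proof.
apply/funext => y; rewrite /kcomb big_map /=.
by apply: eq_bigr => e _; rewrite kinv.
Qed.

(** The boundedness condition on the kernel, read for combinations. *)
Lemma cnorm_shift xi p : SZ O p -> exists q c, [/\ SZ O q, 0 <= c &
  forall u, cnorm k p (cshift xi u) <= c * cnorm k q u].
Proof.
move=> pS; have [q [c [qS c0 H]]] := kbnd xi pS; exists q, c; split=> // u.
have [n [t [x ->]]] := seq_ord u.
have E (b : X -> X) : cform [seq (t j, b (x j)) | j <- enum 'I_n]
    (kcomb k [seq (t j, b (x j)) | j <- enum 'I_n]) =
    \sum_(j < n) \sum_(l < n) (t j * (t l)^*) *: k (b (x l)) (b (x j)).
  rewrite cform_ord exchange_big; apply: eq_bigr => l _.
  by rewrite kcomb_ord scaler_sumr; apply: eq_bigr => j _;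
    rewrite scalerA mulrC.
rewrite /cnorm /cshift -map_comp /= (E (a xi)) (E id).
rewrite -[c](ger0_norm c0) -sqrtr_sqr -sqrtrM ?sqr_ge0// ler_wsqrtr//.
Qed.

(** Moving the shift to the combination v would leave the norm of the shifted v
    for q, which no multiple of the norm of v for p controls. Instead f is
    replaced by a combination u, for which the estimate is that of cnorm_shift.
    The norm of the shifted v only multiplies the error of the approximation and
    disappears in the limit. *)
Lemma dual_bound_shift xi p q (c d : R) f :
  SZ O p -> SZ O q -> 0 <= c -> 0 <= d ->
  (forall u, cnorm k p (cshift xi u) <= c * cnorm k q u) ->
  approximable O k f -> dual_bound O k q d f ->
  dual_bound O k p (4 * c * d) (f \o a (star xi)).
Proof.
move=> pS qS c0 d0 H fA fd r rS rp v.
apply: (@ler_forall_addM _ _ _ (cnorm k r (cshift (star xi) v) +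
  4 * c * cnorm k r v)).
move=> e e0; have [u Hu] := fA _ e (SZD pS qS) e0.
have Hr : r (cform (cshift (star xi) v) (f - kcomb k u)) <=
    e * cnorm k r (cshift (star xi) v).
  by apply: Hu => // z; rewrite (le_trans (rp z))// lerDl (SZ_ge0 _ qS).
have uq : cnorm k q u <= d + e.
  apply: (cnorm_dual_bound qS); first by rewrite addr_ge0// ltW.
  rewrite -(subKr f (kcomb k u)); apply: dual_boundB => //.
  by apply: dual_bound_le Hu => z; rewrite lerDr (SZ_ge0 _ pS).
have h2 := cform_bound kpsd v (cshift xi u) rS.
have h3 : cnorm k r (cshift xi u) <= c * (d + e).
  apply: le_trans (cnorm_le _ _ rp) _; apply: le_trans (H u) _.
  by rewrite ler_wpM2l.
have v0 := cnorm_ge0 k r v.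
have h4 : 4 * cnorm k r v * cnorm k r (cshift xi u) <=
  4 * cnorm k r v * (c * (d + e)).
  by rewrite ler_wpM2l// mulr_ge0.
rewrite cform_shift in Hr.
have [[rD _] _ _] := rS.
have := rD (cform v ((f - kcomb k u) \o a (star xi)))
  (cform v (kcomb k (cshift xi u))).
rewrite -cformD kcomb_shift.
have -> : ((f - kcomb k u) \o a (star xi)) + (kcomb k u \o a (star xi)) =
  f \o a (star xi).
  by apply/funext => y; rewrite -[RHS](subrK (kcomb k u (a (star xi) y))).
rewrite kcomb_shift in h2.
move=> h1; lra.
Qed.

Lemma approximable_shift xi f : approximable O k f ->
  approximable O k (f \o a (star xi)).
Proof.
move=> fA p e pS e0; have [q [c [qS c0 H]]] := cnorm_shift xi pS.
have c1 : 0 < 4 * c + 1 by lra.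
have d0 : 0 < e / (4 * c + 1) by rewrite divr_gt0.
have [u Hu] := fA q _ qS d0; exists (cshift xi u).
have uA : approximable O k (f - kcomb k u).
  by apply: approximable_sub => //; exact: approximable_kcomb.
have := dual_bound_shift pS qS c0 (ltW d0) H uA Hu.
rewrite kcomb_shift; apply: dual_bound_weaken.
by rewrite mulrCA ger_pMr// ler_pdivrMr// mul1r lerDl.
Qed.

Definition rk_shift xi (f : S) : S :=
  RKSpace (introT (rk_predP O k _) (approximable_shift xi (rkA f))).

Lemma rk_shift_linear xi : linear (rk_shift xi).
Proof. by move=> c f h; apply: val_inj; rewrite [RHS]linearP. Qed.

HB.instance Definition _ xi := GRing.isLinear.Build R[i] S S _ (rk_shift xi)
  (rk_shift_linear xi).

Lemma rk_shift_continuous xi : ve_continuous g (rk_shift xi).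
Proof.
apply/ve_continuousP => p pS; have [q [c [qS c0 H]]] := cnorm_shift xi pS.
exists q, (4 * c * 4); split=> // [|f]; first by rewrite !mulr_ge0.
have n0 := gramnorm_ge0 g q f.
apply: rk_norm_le => //; first by rewrite !mulr_ge0.
rewrite -mulrA; apply: (dual_bound_shift pS qS c0 _ H (rkA f)).
  by rewrite mulr_ge0.
exact: rk_dual_bound.
Qed.

(** On combinations the adjoint relation is cform_shift; the general case
    follows by approximating f. *)
Lemma rk_shift_adjoint xi : is_adjoint g (rk_shift xi) (rk_shift (star xi)).
Proof.
move=> f h; have fA := rkA f; have hA := rkA h.
apply/esym/(pairing_unique Zadm kpsd) => [||p pS].
- exact: approximable_shift.
- by [].
have h'A : approximable O k (\val h \o a xi).
  by have := approximable_shift (star xi) hA; rewrite sgstarK.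
have [C C0 HC] := approximable_bounded kpsd h'A pS.
have [q [c [qS c0 H]]] := cnorm_shift xi pS.
exists C => d d0.
have c1 : 0 < 4 * c + 1 by lra.
have e0 : 0 < d / (4 * c + 1) by rewrite divr_gt0.
have [u Hu] := fA _ _ (SZD pS qS) e0; exists (cshift xi u).
  rewrite kcomb_shift.
  have uA : approximable O k (\val f - kcomb k u).
    by apply: approximable_sub => //; exact: approximable_kcomb.
  have Huq : dual_bound O k q (d / (4 * c + 1)) (\val f - kcomb k u).
    by apply: dual_bound_le Hu => z; rewrite lerDr (SZ_ge0 _ pS).
  have := dual_bound_shift pS qS c0 (ltW e0) H uA Huq.
  apply: dual_bound_weaken.
  by rewrite mulrCA ger_pMr// ler_pdivrMr// mul1r lerDl.
have Hup : dual_bound O k p (d / (4 * c + 1)) (\val f - kcomb k u).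
  by apply: dual_bound_le Hu => z; rewrite lerDl (SZ_ge0 _ qS).
have -> : g f (rk_shift (star xi) h) = pairing O k (\val f) (\val h \o a xi).
  by rewrite /= /rk_gram /= sgstarK.
rewrite cform_shift.
apply: le_trans (pairingP Zadm kpsd fA h'A pS C0 (ltW e0) HC Hup) _.
by rewrite ler_wpM2l// ler_pdivrMr// ler_peMr ?(ltW d0)// lerDr mulr_ge0.
Qed.

Definition rk_kernel x : S := rk_of O k [:: (1, x)].

Lemma rk_shift_representation :
  rk_representation star a g rk_kernel (fun xi => rk_shift xi).
Proof.
split; last first.
  move=> xi x; apply: val_inj; rewrite /= !kcomb1.
  by apply/funext => y /=; rewrite kinv.
split=> [xi|xi eta f|xi]; last exact: rk_shift_adjoint.
  exists (rk_shift (star xi)); split; first exact: rk_shift_adjoint.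
    exact: rk_shift_continuous.
  exact: rk_shift_continuous.
apply: val_inj; apply/funext => y /=.
by rewrite sgstarM actA.
Qed.

Lemma rk_kernel_vhspace : weak_rk_vhspace k g rk_kernel.
Proof.
split; first exact: psd_hermitian.
- exact: rk_complete.
- by move=> x; rewrite /= kcomb1.
- by move=> f x; rewrite rk_of_form cform1.
Qed.

Lemma rk_kernel_minimal : minimal_rk g rk_kernel.
Proof.
move=> U [f Uf] Uo; have /nbhs_gramnorm := open_nbhs_nbhs (conj Uo Uf).
move=> [p [e [pS e0 pU]]]; have [u fu] := rk_dense Zadm kpsd f pS e0.
exists (rk_of O k u); split.
  by apply: pU; rewrite -(seminormN _ (gramnorm_seminorm g pS)) opprB.
have [n [t [x ->]]] := seq_ord u; exists n, t, (fun j => rk_kernel (x j)).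
split; first by move=> j; exists (x j).
apply: val_inj; rewrite raddf_sum; apply/funext => y.
rewrite /= kcomb_ord fct_sumE; apply: eq_bigr => j _.
by rewrite -[RHS]/(t j *: kcomb k [:: (1, x j)] y) kcomb1.
Qed.

End Shift.

(** * From linearisations back to the kernel *)

Section Linearisation.
Variables (R : realType) (Z : tvsType R[i]) (O : ordered_star Z).
Variables (X : Type) (k : X -> X -> Z).
Variables (G : semigroupType) (star : star_semigroup G) (a : action_on G X).

Lemma gram_comb (K : lmodType R[i]) (g : gramian O K) n
    (t : 'I_n -> R[i]) (x : 'I_n -> K) :
  g (\sum_(j < n) t j *: x j) (\sum_(j < n) t j *: x j) =
  \sum_(j < n) \sum_(l < n) ((t l)^* * t j) *: g (x l) (x j).
Proof.
have g0l y : g 0 y = 0.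
  by have := gramZl g 0 y y; rewrite rmorph0 !scale0r.
have g0r y : g y 0 = 0.
  by have := gramZr g 0 y y; rewrite !scale0r.
rewrite (big_morph (g _) (gramDr g _) (g0r _)); apply: eq_bigr => j _.
rewrite (big_morph (g^~ _) (fun y z => gramDl g y z _) (g0l _));
  apply: eq_bigr => l _.
by rewrite gramZl gramZr scalerA.
Qed.

(** Sums of kernel values weighted by t are the squares of the vectors sum_j t_j
    V(x_j); the three conditions are positivity of the gramian, the adjoint
    relation and continuity of pi(alpha). *)
Lemma linearisation_kernel_conditions (K : lmodType R[i]) (g : gramian O K)
    (pi : G -> {linear K -> K}) (V : X -> K) :
  weak_vh_linearisation k star a g pi V ->
  [/\ weakly_psd O k, invariant_kernel k star a & bounded_shifts O k a].
Proof.
case=> _ kV [piL piM piA] Vpi; split.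
- move=> n x t; have := gram_ge0 g (\sum_(j < n) t j *: V (x j)).
  rewrite gram_comb; congr (zle O 0 _).
  by apply: eq_bigr => j _; apply: eq_bigr => l _; rewrite kV.
- by move=> x y xi; rewrite !kV !Vpi piA sgstarK.
- move=> al p pS; have [T [_ piC _]] := piL al.
  have [q [c [qS c0 H]]] := (ve_continuousP _ _).1 piC p pS.
  exists q, c; split=> // n x t.
  have E (b : X -> X) :
     \sum_(j < n) \sum_(l < n) (t j * (t l)^*) *: k (b (x l)) (b (x j)) =
     g (\sum_(j < n) t j *: V (b (x j))) (\sum_(j < n) t j *: V (b (x j))).
    rewrite gram_comb; apply: eq_bigr => j _; apply: eq_bigr => l _.
    by rewrite kV mulrC.
  rewrite (E (a al)) (E id).
  have -> : \sum_(j < n) t j *: V (a al (x j)) =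
    pi al (\sum_(j < n) t j *: V (x j)).
    by rewrite linear_sum; apply: eq_bigr => j _; rewrite linearZ /= Vpi.
  have := H (\sum_(j < n) t j *: V (x j)); set v := \sum_(j < n) _ => Hv.
  have := lerXn2r 2 (gramnorm_ge0 _ _ _) (le_trans (gramnorm_ge0 _ _ _) Hv) Hv.
  by rewrite exprMn !sqr_sqrtr ?(SZ_ge0 _ pS) ?(SZ_ge0 _ qS).
Qed.

Lemma rkspace_linearisation (P : pred (X -> Z)) (S : subLmodType P)
    (g : gramian O S) (kx : X -> S) (rho : G -> {linear S -> S}) :
  weak_rk_vhspace k g kx -> rk_representation star a g kx rho ->
  weak_vh_linearisation k star a g rho kx.
Proof.
case=> _ gc kxE rep [rhoS rhok]; split=> // x y.
by rewrite -rep kxE.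
Qed.

End Linearisation.

Theorem theorem4p6 (R : realType) (Z : tvsType R[i]) (O : ordered_star Z)
    (Zadm : admissible O)
    (G : semigroupType) (star : star_semigroup G)
    (X : Type) (X0 : inhabited X) (a : action_on G X) (k : X -> X -> Z) :
  let P1 :=
    [/\ weakly_psd O k, invariant_kernel k star a & bounded_shifts O k a] in
  let P2 :=
    exists (K : lmodType R[i]) (g : gramian O K) (pi : G -> {linear K -> K})
           (V : X -> K),
      weak_vh_linearisation k star a g pi V in
  let P3 :=
    exists (P : pred (X -> Z)) (S : subLmodType P) (g : gramian O S)
           (kx : X -> S),
      weak_rk_vhspace k g kx /\
      exists rho : G -> {linear S -> S}, rk_representation star a g kx rho in
  [/\ P1 <-> P2, P2 <-> P3 &
      P1 \/ P2 \/ P3 ->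
      (exists (K : lmodType R[i]) (g : gramian O K) (pi : G -> {linear K -> K})
              (V : X -> K),
         weak_vh_linearisation k star a g pi V /\ minimal_linearisation g V) /\
      (exists (P : pred (X -> Z)) (S : subLmodType P) (g : gramian O S)
              (kx : X -> S),
         [/\ weak_rk_vhspace k g kx, minimal_rk g kx &
             exists rho : G -> {linear S -> S},
               rk_representation star a g kx rho])].
Proof.
move=> P1 P2 P3.
have P21 : P2 -> P1.
  by case=> K [g [pi [V]]]; exact: linearisation_kernel_conditions.
have P32 : P3 -> P2.
  case=> P [S [g [kx [kxS [rho rhoS]]]]]; exists S, g, rho, kx.
  exact: rkspace_linearisation.
have P1min : P1 ->
    exists (P : pred (X -> Z)) (S : subLmodType P) (g : gramian O S)
      (kx : X -> S), [/\ weak_rk_vhspace k g kx, minimal_rk g kx &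
      exists rho : G -> {linear S -> S}, rk_representation star a g kx rho].
  case=> kpsd kinv kbnd.
  exists _, (rkspace O k), (rk_gramian Zadm kpsd), (@rk_kernel _ _ O _ k).
  split; [exact: rk_kernel_vhspace|exact: rk_kernel_minimal|].
  by eexists; exact: (rk_shift_representation Zadm kpsd kinv kbnd).
have P13 : P1 -> P3.
  by move=> /P1min[P [S [g [kx [kxS _ rhoS]]]]]; exists P, S, g, kx.
split; [by split=> // /P13/P32|by split=> // /P21/P13|].
move=> H; have {H} /P1min[P [S [g [kx [kxS kxm [rho rhoS]]]]]] : P1.
  by case: H => [//|[/P21//|/P32/P21]].
split; last by exists P, S, g, kx; split=> //; exists rho.
exists S, g, rho, kx; split=> //; exact: rkspace_linearisation.
Qed.
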